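(* Let $h^\downarrow:\mathbb Z\to\mathbb R$ be defined by $h^\downarrow(\ell)=2^{-2\ell}\binom{2\ell}{\ell}$ for $\ell\ge0$ and $h^\downarrow(\ell)=0$ for $\ell\le -1$. Let $\nu$ be a probability distribution on $\mathbb Z$ such that $h^\downarrow$ is $\nu$-harmonic on $\mathbb Z_{\ge1}$, i.e. $h^\downarrow(p)=\sum_{k\in\mathbb Z}\nu(k)h^\downarrow(p+k)$ for all $p\ge1$, and such that $\nu$ is not the Dirac mass $\delta_0$ at $0$. Assume that $$\forall k\ge1,\qquad \nu(k-1)\ge \nu(-k-1).$$ Then exactly one of the following holds: (i) $\sum_{k\ge1}k\big(\nu(k-1)-\nu(-k-1)\big)\in[0,1)$ and there exists $c>0$ such that $\nu(-k)\sim \dfrac{c\log k}{k^2}$ as $k\to\infty$; (ii) $\sum_{k\ge1}k\big(\nu(k-1)-\nu(-k-1)\big)=1$ and there exists a slowly varying function $L$ with $L(k)=o(\log k)$ and $1=O(L(k))$ as $k\to\infty$, such that $\nu(-k)\sim \dfrac{L(k)}{k^2}$ as $k\to\infty$.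
   Context: A function $L:\mathbb R_+\to\mathbb R$ is slowly varying if $L(\lambda x)/L(x)\to1$ as $x\to\infty$ for every $\lambda>0$. *)

(* Defs.v *)
From Stdlib Require Import Reals ZArith.
From Coquelicot Require Import Coquelicot.
Open Scope R_scope.

Definition hdown (l : Z) : R :=
  if (l <? 0)%Z then 0
  else Binomial.C (2 * Z.to_nat l) (Z.to_nat l) / 4 ^ (Z.to_nat l).

(* Summation over Z: the sum over k >= 0 and the sum over k <= -1 both
   converge, and s is their total. (Used only for nonnegative terms.) *)
Definition is_Zsum (f : Z -> R) (s : R) : Prop :=
  exists a b : R,
    is_series (fun n : nat => f (Z.of_nat n)) a /\
    is_series (fun n : nat => f (- Z.of_nat n - 1)%Z) b /\
    s = a + b.

Definition is_prob_Z (nu : Z -> R) : Prop :=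
  (forall k, 0 <= nu k) /\ is_Zsum nu 1.

Definition dirac0 (k : Z) : R := if (k =? 0)%Z then 1 else 0.

Definition harmonic_on_pos (nu : Z -> R) (h : Z -> R) : Prop :=
  forall p : Z, (1 <= p)%Z -> is_Zsum (fun k => nu k * h (p + k)%Z) (h p).

Definition seq_equiv (u v : nat -> R) : Prop :=
  forall eps : R, 0 < eps ->
    exists N : nat, forall n : nat, (N <= n)%nat ->
      Rabs (u n - v n) <= eps * Rabs (v n).

Definition slowly_varying (L : R -> R) : Prop :=
  forall lam : R, 0 < lam ->
    is_lim (fun x => L (lam * x) / L x) p_infty 1.

Definition seq_littleo (u v : nat -> R) : Prop :=
  forall eps : R, 0 < eps ->
    exists N : nat, forall n : nat, (N <= n)%nat ->
      Rabs (u n) <= eps * Rabs (v n).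

Definition seq_bigO (u v : nat -> R) : Prop :=
  exists K : R, 0 < K /\
    exists N : nat, forall n : nat, (N <= n)%nat ->
      Rabs (u n) <= K * Rabs (v n).

(* The drift-type sum  sum_{k>=1} k (nu(k-1) - nu(-k-1)), indexed by n = k-1. *)
Definition drift_term (nu : Z -> R) (n : nat) : R :=
  (INR n + 1) * (nu (Z.of_nat n) - nu (- Z.of_nat n - 2)%Z).

(* Main.v *)
(* Put h = hdown, put h (p) = 0 for p < 0, and let gap n = nu (n) - nu (- n - 2) >= 0.

   The autocorrelation differences of h are explicit: for integers a, b >= 0, the sum over i of
   h (i) (h (i + a) - h (i + b)) is a positive constant times H (b) - H (a), where
   H (j) = 1 + 1/3 + ... + 1/(2j - 1). Testing the harmonicity relations at p = i + 1 against
   h (i + m) - h (i - m) therefore produces, up to a remainder involving only nonnegative k, the sum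
   over n of gap n K (m, n + 1), with K (m, j) = H (m + j) - H (|m - j|). Averaging over m with the
   beta weights 1 / ((N + m - 3/2) (N + m - 1/2)) turns the remainder into the one obtained from
   testing against the Taylor coefficients of (1 - z)^(1/2), and gives the exact formula
     c (N - 3/2) (N - 1/2) nu (- N) = phi (N, 1) - (sum over n of gap n phi (N, n + 1)),
   where phi (x, j) is the weighted average of K (., j).

   One has phi (x, 1) = ln x + O(1), and phi_defect (x, j) = j phi (x, 1) - phi (x, j) is
   nonnegative for large x, converges as x tends to infinity to a limit which is positive for
   j >= 2, is much larger than j when x and j are both large, and changes by O(j) when x is
   multiplied by a constant. Nonnegativity of nu (- N) thus forces the drift s to be at most 1, and
     c (N - 3/2) (N - 1/2) nu (- N) = (1 - s) phi (N, 1) + (sum over n of gap n phi_defect (N, n + 1)),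
   where the last sum is o(ln N), slowly varying, and bounded below if s = 1. *)
Require Import Defs.
From Stdlib Require Import Reals ZArith Lra Lia Psatz Classical FunctionalExtensionality.
From Coquelicot Require Import Coquelicot.
Open Scope R_scope.

(** * Finite sums over [i < n], series, and exchange of summations *)

Fixpoint psum (f : nat -> R) (n : nat) : R :=
  match n with O => 0 | S m => psum f m + f m end.

Lemma psum_ext f g n : (forall i, (i < n)%nat -> f i = g i) -> psum f n = psum g n.
Proof.
  induction n as [|n IH]; intros H; simpl; [reflexivity|].
  rewrite IH by (intros; apply H; lia). rewrite H by lia. reflexivity.
Qed.

Lemma psum_plus f g n : psum (fun i => f i + g i) n = psum f n + psum g n.
Proof. induction n as [|n IH]; simpl; [|rewrite IH]; ring. Qed.

Lemma psum_minus f g n : psum (fun i => f i - g i) n = psum f n - psum g n.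
Proof. induction n as [|n IH]; simpl; [|rewrite IH]; ring. Qed.

Lemma psum_scal c f n : psum (fun i => c * f i) n = c * psum f n.
Proof. induction n as [|n IH]; simpl; [|rewrite IH]; ring. Qed.

Lemma psum_le f g n : (forall i, (i < n)%nat -> f i <= g i) -> psum f n <= psum g n.
Proof.
  induction n as [|n IH]; intros H; simpl; [lra|].
  apply Rplus_le_compat; [apply IH; intros; apply H; lia | apply H; lia].
Qed.

Lemma psum_zero f n : (forall i, (i < n)%nat -> f i = 0) -> psum f n = 0.
Proof.
  induction n as [|n IH]; intros H; simpl; [lra|].
  rewrite IH by (intros; apply H; lia). rewrite H by lia. ring.
Qed.

Lemma psum_nonneg f n : (forall i, (i < n)%nat -> 0 <= f i) -> 0 <= psum f n.
Proof.
  intros H. rewrite <- (psum_zero (fun _ => 0) n) by reflexivity. now apply psum_le.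
Qed.

Lemma psum_split f n m : psum f (n + m) = psum f n + psum (fun i => f (n + i)%nat) m.
Proof.
  induction m as [|m IH]; simpl.
  - rewrite Nat.add_0_r. ring.
  - rewrite Nat.add_succ_r. simpl. rewrite IH. ring.
Qed.

Lemma psum_head f n : psum f (S n) = f 0%nat + psum (fun i => f (S i)) n.
Proof. change (S n) with (1 + n)%nat. rewrite psum_split. simpl. ring. Qed.

Lemma psum_rev f n : psum f n = psum (fun i => f (n - 1 - i)%nat) n.
Proof.
  induction n as [|n IH]; [reflexivity|].
  rewrite (psum_head (fun i => f (S n - 1 - i)%nat)). simpl psum at 1. rewrite IH.
  replace (S n - 1 - 0)%nat with n by lia. rewrite Rplus_comm. f_equal.
  apply psum_ext. intros i Hi. f_equal. lia.
Qed.

Lemma psum_telescope f n : psum (fun i => f (S i) - f i) n = f n - f 0%nat.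
Proof. induction n as [|n IH]; simpl; [|rewrite IH]; ring. Qed.

Lemma psum_mono f n m :
  (forall i, 0 <= f i) -> (n <= m)%nat -> psum f n <= psum f m.
Proof.
  intros Hf Hnm. replace m with (n + (m - n))%nat by lia. rewrite psum_split.
  pose proof (psum_nonneg (fun i => f (n + i)%nat) (m - n) (fun i _ => Hf _)). lra.
Qed.

Lemma sum_n_psum (f : nat -> R) n : sum_n f n = psum f (S n).
Proof.
  induction n as [|n IH].
  - rewrite sum_O. simpl. ring.
  - rewrite sum_Sn, IH. reflexivity.
Qed.

Lemma is_series_psum (f : nat -> R) (l : R) :
  is_series f l <-> is_lim_seq (psum f) l.
Proof.
  rewrite is_lim_seq_incr_1. split; intros H.
  - apply is_lim_seq_ext with (sum_n f); [apply sum_n_psum | exact H].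
  - apply (is_lim_seq_ext _ (sum_n f)) in H; [exact H |].
    intros n. symmetry. apply sum_n_psum.
Qed.

Lemma is_series_eq (f g : nat -> R) (l l' : R) :
  (forall n, f n = g n) -> l = l' -> is_series f l -> is_series g l'.
Proof. intros H <- Hf. now apply is_series_ext with f. Qed.

Lemma is_series_add (f g : nat -> R) (a b : R) :
  is_series f a -> is_series g b -> is_series (fun n => f n + g n) (a + b).
Proof. exact (is_series_plus f g a b). Qed.

Lemma is_series_sub (f g : nat -> R) (a b : R) :
  is_series f a -> is_series g b -> is_series (fun n => f n - g n) (a - b).
Proof. exact (is_series_minus f g a b). Qed.

Lemma is_series_mult_l (c : R) (f : nat -> R) (a : R) :
  is_series f a -> is_series (fun n => c * f n) (c * a).
Proof. exact (is_series_scal c f a). Qed.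

Lemma is_series_uniq (f : nat -> R) (a b : R) : is_series f a -> is_series f b -> a = b.
Proof. intros Ha Hb. rewrite <- (is_series_unique _ _ Ha). now apply is_series_unique. Qed.

Lemma ex_series_is (f : nat -> R) : ex_series f -> is_series f (Series f).
Proof. apply Series_correct. Qed.

Lemma is_series_drop (f : nat -> R) (l : R) n :
  is_series f l <-> is_series (fun i => f (n + i)%nat) (l - psum f n).
Proof.
  rewrite !is_series_psum. rewrite (is_lim_seq_incr_n (psum f) n).
  split; intros H.
  - apply is_lim_seq_ext with (fun k => psum f (k + n) - psum f n).
    + intros k. rewrite Nat.add_comm, psum_split. ring.
    + apply is_lim_seq_minus' ; [exact H | apply is_lim_seq_const].
  - apply is_lim_seq_ext with (fun k => psum (fun i => f (n + i)%nat) k + psum f n).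
    + intros k. rewrite (Nat.add_comm k), psum_split. ring.
    + replace l with ((l - psum f n) + psum f n) by ring.
      apply is_lim_seq_plus' ; [exact H | apply is_lim_seq_const].
Qed.

Lemma is_series_finite (f : nat -> R) n :
  (forall i, (n <= i)%nat -> f i = 0) -> is_series f (psum f n).
Proof.
  intros H. apply (is_series_drop f _ n).
  apply is_series_psum. apply is_lim_seq_ext with (fun _ => 0).
  - intros k. symmetry. apply psum_zero. intros. apply H. lia.
  - replace (psum f n - psum f n) with 0 by ring. apply is_lim_seq_const.
Qed.

Lemma is_series_lsum (f : nat -> nat -> R) (a : nat -> R) N :
  (forall i, (i < N)%nat -> is_series (f i) (a i)) ->
  is_series (fun n => psum (fun i => f i n) N) (psum a N).
Proof.
  induction N as [|N IH]; intros H; simpl.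
  - apply (is_series_finite (fun _ => 0) 0). reflexivity.
  - apply is_series_add; [apply IH; intros; apply H; lia | apply H; lia].
Qed.

Lemma psum_le_series (f : nat -> R) (l : R) n :
  (forall i, 0 <= f i) -> is_series f l -> psum f n <= l.
Proof.
  intros Hf Hl. apply is_series_psum in Hl.
  apply (is_lim_seq_incr_compare (psum f)); [exact Hl |].
  intros k. simpl. pose proof (Hf k). lra.
Qed.

Lemma series_nonneg (f : nat -> R) (l : R) : (forall i, 0 <= f i) -> is_series f l -> 0 <= l.
Proof. intros Hf Hl. exact (psum_le_series f l 0 Hf Hl). Qed.

Lemma series_le (f g : nat -> R) (a b : R) :
  (forall i, f i <= g i) -> is_series f a -> is_series g b -> a <= b.
Proof.
  intros H Ha Hb. apply is_series_psum in Ha, Hb.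
  assert (K : Rbar_le a b); [|exact K].
  apply is_lim_seq_le with (psum f) (psum g); auto.
  intros n. apply psum_le. auto.
Qed.

Lemma series_abs_le (f g : nat -> R) (a b : R) :
  (forall i, Rabs (f i) <= g i) -> is_series f a -> is_series g b -> Rabs a <= b.
Proof.
  intros H Ha Hb. apply Rabs_le. split.
  - replace (- b) with (-1 * b) by ring.
    apply series_le with (2 := is_series_mult_l (-1) _ _ Hb) (3 := Ha).
    intros i. pose proof (H i). apply Rabs_le_between in H0. lra.
  - apply series_le with (2 := Ha) (3 := Hb).
    intros i. pose proof (H i). apply Rabs_le_between in H0. lra.
Qed.

Lemma series_bounded (f : nat -> R) (M : R) :
  (forall i, 0 <= f i) -> (forall n, psum f n <= M) ->
  exists l : R, is_series f l /\ l <= M.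
Proof.
  intros Hf HM.
  destruct (ex_finite_lim_seq_incr (psum f) M) as [l Hl].
  - intros n. simpl. pose proof (Hf n). lra.
  - exact HM.
  - exists l. split; [now apply is_series_psum|].
    assert (K : Rbar_le l M); [|exact K].
    apply is_lim_seq_le with (psum f) (fun _ => M); auto. apply is_lim_seq_const.
Qed.

Lemma series_dominated (f g : nat -> R) (b : R) :
  (forall i, Rabs (f i) <= g i) -> is_series g b ->
  exists a : R, is_series f a /\ Rabs a <= b.
Proof.
  intros H Hg.
  assert (E : ex_series f).
  { apply (ex_series_le f g); [exact H | now exists b]. }
  exists (Series f). apply ex_series_is in E. split; [exact E|].
  now apply series_abs_le with f g.
Qed.

(** Half of Tonelli's theorem. An entry is at most its row sum, so every column converges by
    domination; finitely many columns add up to a series dominated by the row sums, hence to at most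
    [s]. *)
Lemma series_swap_nonneg_le (f : nat -> nat -> R) (r : nat -> R) (s : R) :
  (forall i j, 0 <= f i j) ->
  (forall i, is_series (f i) (r i)) -> is_series r s ->
  exists (c : nat -> R) (s' : R), (forall j, is_series (fun i => f i j) (c j)) /\ is_series c s' /\ s' <= s.
Proof.
  intros Hf Hr Hs.
  assert (Hr0 : forall i, 0 <= r i) by (intros i; now apply (series_nonneg (f i))).
  assert (Hle : forall i j, f i j <= r i).
  { intros i j. apply Rle_trans with (psum (f i) (S j)).
    - simpl. pose proof (psum_nonneg (f i) j (fun k _ => Hf i k)). lra.
    - now apply psum_le_series. }
  assert (Hc : forall j, is_series (fun i => f i j) (Series (fun i => f i j))).
  { intros j. apply ex_series_is.
    destruct (series_dominated (fun i => f i j) r s) as [a [Ha _]]; [| exact Hs | now exists a].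
    intros i. rewrite Rabs_pos_eq by apply Hf. apply Hle. }
  destruct (series_bounded (fun j => Series (fun i => f i j)) s) as [s' [H1 H2]].
  - intros j. now apply (series_nonneg (fun i => f i j)).
  - intros m.
    apply series_le with (2 := is_series_lsum (fun j i => f i j) _ m (fun j _ => Hc j)) (3 := Hs).
    intros i. now apply psum_le_series.
  - exists (fun j => Series (fun i => f i j)), s'. auto.
Qed.

Lemma series_swap_nonneg (f : nat -> nat -> R) (r : nat -> R) (s : R) :
  (forall i j, 0 <= f i j) ->
  (forall i, is_series (f i) (r i)) -> is_series r s ->
  exists c : nat -> R, (forall j, is_series (fun i => f i j) (c j)) /\ is_series c s.
Proof.
  intros Hf Hr Hs.
  destruct (series_swap_nonneg_le f r s Hf Hr Hs) as (c & s' & Hc & Hs' & Hle).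
  exists c. split; [exact Hc|].
  (* The same half for the transposed family returns to the rows and gives [s <= s']. *)
  destruct (series_swap_nonneg_le (fun j i => f i j) c s') as (r' & s'' & Hr' & Hs'' & Hle'); auto.
  assert (s'' = s).
  { apply is_series_uniq with r; [|exact Hs]. apply is_series_ext with r'; [|exact Hs''].
    intros i. now apply is_series_uniq with (f i). }
  replace s with s' by lra. exact Hs'.
Qed.

(** Fubini's theorem, from Tonelli's applied to the nonnegative families [F] and [F + f], followed
    by a subtraction. *)
Lemma series_swap (f F : nat -> nat -> R) (a r c : nat -> R) (S : R) :
  (forall i j, Rabs (f i j) <= F i j) ->
  (forall i, is_series (F i) (r i)) -> ex_series r ->
  (forall i, is_series (f i) (a i)) ->
  (forall j, is_series (fun i => f i j) (c j)) ->
  is_series a S -> is_series c S.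
Proof.
  intros Hb HF [sr Hr] Hf Hc HS.
  assert (P : forall i j, 0 <= F i j /\ 0 <= F i j + f i j).
  { intros i j. pose proof (Hb i j). pose proof (Rabs_pos (f i j)).
    apply Rabs_le_between in H. lra. }
  destruct (series_swap_nonneg F r sr) as (c1 & H1 & K1); auto.
  { intros; apply P. }
  destruct (series_swap_nonneg (fun i j => F i j + f i j) (fun i => r i + a i) (sr + S))
    as (c2 & H2 & K2).
  { intros; apply P. }
  { intros i. now apply is_series_add. }
  { now apply is_series_add. }
  apply is_series_eq with (3 := is_series_sub _ _ _ _ K2 K1); [|ring].
  intros j. apply is_series_uniq with (fun i => f i j); [|apply Hc].
  apply is_series_eq with (3 := is_series_sub _ _ _ _ (H2 j) (H1 j)); [|ring].
  intros i. ring.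
Qed.

(** * The coefficients of [(1 - z)^(-1/2)] and of its inverse *)

Definition hnat (n : nat) : R := Binomial.C (2 * n) n / 4 ^ n.

Lemma hdown_nat n : hdown (Z.of_nat n) = hnat n.
Proof.
  unfold hdown, hnat. destruct (Z.ltb_spec (Z.of_nat n) 0); [lia|]. now rewrite Nat2Z.id.
Qed.

Lemma hdown_neg z : (z < 0)%Z -> hdown z = 0.
Proof. intros H. unfold hdown. destruct (Z.ltb_spec z 0); [reflexivity|lia]. Qed.

Lemma hnat_0 : hnat 0 = 1.
Proof. unfold hnat, Binomial.C. simpl. field. Qed.

Lemma hnat_S n : hnat (S n) = hnat n * ((2 * INR n + 1) / (2 * INR n + 2)).
Proof.
  unfold hnat, Binomial.C.
  replace (2 * S n - S n)%nat with (S n) by lia.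
  replace (2 * n - n)%nat with n by lia.
  replace (2 * S n)%nat with (S (S (2 * n))) by lia.
  rewrite !fact_simpl, !mult_INR. rewrite !S_INR, mult_INR. simpl (4 ^ S n).
  change (INR 2) with 2.
  pose proof (INR_fact_neq_0 n). pose proof (pos_INR n). pose proof (pow_nonzero 4 n).
  field. repeat split; lra.
Qed.

Lemma hnat_pos n : 0 < hnat n.
Proof.
  induction n as [|n IH]; [rewrite hnat_0; lra|].
  rewrite hnat_S. pose proof (pos_INR n).
  apply Rmult_lt_0_compat; [exact IH|]. apply Rdiv_lt_0_compat; lra.
Qed.

Lemma hnat_le n d : hnat (n + d) <= hnat n.
Proof.
  induction d as [|d IH]; [rewrite Nat.add_0_r; lra|].
  rewrite Nat.add_succ_r, hnat_S. pose proof (pos_INR (n + d)). pose proof (hnat_pos (n + d)).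
  assert ((2 * INR (n + d) + 1) / (2 * INR (n + d) + 2) <= 1)
    by (apply Rle_div_l; lra).
  nra.
Qed.

Lemma hnat_le1 n : hnat n <= 1.
Proof. rewrite <- hnat_0. apply (hnat_le 0 n). Qed.

Lemma hdown_bounds z : 0 <= hdown z <= 1.
Proof.
  destruct (Z.lt_ge_cases z 0) as [H|H].
  - rewrite hdown_neg by exact H. lra.
  - rewrite <- (Z2Nat.id z H), hdown_nat. pose proof (hnat_pos (Z.to_nat z)).
    pose proof (hnat_le1 (Z.to_nat z)). lra.
Qed.

(** A Wallis-type bound: the induction step reduces to [(2x + 1)(2x + 3) <= (2x + 2)^2]. *)
Lemma hnat_sq_le n : hnat n * hnat n <= 1 / (2 * INR n + 1).
Proof.
  induction n as [|n IH]; [rewrite hnat_0; simpl; lra|].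
  rewrite hnat_S, S_INR. pose proof (pos_INR n) as Hn. set (x := INR n) in *.
  set (r := (2 * x + 1) / (2 * x + 2)).
  replace (hnat n * r * (hnat n * r)) with (hnat n * hnat n * (r * r)) by ring.
  apply Rle_trans with (1 / (2 * x + 1) * (r * r)).
  - apply Rmult_le_compat_r; [apply Rle_0_sqr | exact IH].
  - unfold r. apply Rminus_le.
    replace (1 / (2 * x + 1) * ((2 * x + 1) / (2 * x + 2) * ((2 * x + 1) / (2 * x + 2))) -
      1 / (2 * (x + 1) + 1)) with (- (1 / ((2 * x + 2) * (2 * x + 2) * (2 * x + 3)))) by (field; lra).
    enough (0 < 1 / ((2 * x + 2) * (2 * x + 2) * (2 * x + 3))) by lra.
    apply Rdiv_lt_0_compat; [lra|]. repeat apply Rmult_lt_0_compat; lra.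
Qed.

Lemma is_lim_seq_hnat : is_lim_seq hnat 0.
Proof.
  apply is_lim_seq_spec. intros eps. simpl.
  destruct (nfloor_ex (1 / (eps * eps))) as [N [_ HN]].
  { apply Rlt_le, Rdiv_lt_0_compat; [lra|]. destruct eps as [e He]; simpl; nra. }
  exists N. intros n Hn. rewrite Rminus_0_r, Rabs_pos_eq by apply Rlt_le, hnat_pos.
  apply Rnot_le_lt. intros Hle. pose proof (hnat_sq_le n). pose proof (cond_pos eps) as He.
  apply le_INR in Hn. pose proof (pos_INR N).
  assert (eps * eps <= 1 / (2 * INR n + 1)) by nra.
  apply Rle_div_r in H1; [|lra]. apply Rlt_div_l in HN; [|nra]. nra.
Qed.

(* Minus the coefficient of [z ^ (q + 1)] in [(1 - z)^(1/2)]. *)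
Definition sqrt_tail (q : nat) : R := hnat q - hnat (S q).

Lemma sqrt_tail_eq q : sqrt_tail q = hnat q / (2 * INR q + 2).
Proof. unfold sqrt_tail. rewrite hnat_S. pose proof (pos_INR q). field. lra. Qed.

Lemma sqrt_tail_pos q : 0 < sqrt_tail q.
Proof. rewrite sqrt_tail_eq. pose proof (pos_INR q). apply Rdiv_lt_0_compat; [apply hnat_pos|lra]. Qed.

Lemma sqrt_tail_S q : sqrt_tail (S q) = sqrt_tail q * ((2 * INR q + 1) / (2 * INR q + 4)).
Proof. rewrite !sqrt_tail_eq, hnat_S, S_INR. pose proof (pos_INR q). field. lra. Qed.

(** The square of [(1 - z)^(-1/2)] is [1 / (1 - z)]. The induction mimics the differential equation
    of the generating function: [Y] and [W] are the convolutions at [n + 1] and [n] weighted by the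
    index [i]. The symmetry of the convolution gives [2 Y = (n + 1) X] and [2 W = n], and the
    recurrence of [hnat] gives [2 Y = 2 W + 1]. *)
Lemma hnat_conv n : psum (fun i => hnat i * hnat (n - i)) (S n) = 1.
Proof.
  induction n as [|n IH]; [simpl; rewrite hnat_0; ring|].
  set (X := psum (fun i => hnat i * hnat (S n - i)) (S (S n))).
  set (Y := psum (fun i => INR i * (hnat i * hnat (S n - i))) (S (S n))).
  set (W := psum (fun i => INR i * (hnat i * hnat (n - i))) (S n)).
  assert (HY : 2 * Y = (INR n + 1) * X).
  { assert (E : Y = psum (fun i => INR (S n - i) * (hnat i * hnat (S n - i))) (S (S n))).
    { unfold Y. rewrite psum_rev. apply psum_ext. intros i Hi.
      replace (S (S n) - 1 - i)%nat with (S n - i)%nat by lia.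
      replace (S n - (S n - i))%nat with i by lia. ring. }
    replace (2 * Y) with (Y + Y) by ring. rewrite E at 2. unfold Y.
    rewrite <- psum_plus. unfold X. rewrite <- psum_scal. apply psum_ext. intros i Hi.
    rewrite minus_INR by lia. rewrite S_INR. ring. }
  assert (HW : 2 * W = INR n).
  { assert (E : W = psum (fun i => INR (n - i) * (hnat i * hnat (n - i))) (S n)).
    { unfold W. rewrite psum_rev. apply psum_ext. intros i Hi.
      replace (S n - 1 - i)%nat with (n - i)%nat by lia.
      replace (n - (n - i))%nat with i by lia. ring. }
    replace (2 * W) with (W + W) by ring. rewrite E at 2. unfold W.
    rewrite <- psum_plus. rewrite <- (Rmult_1_r (INR n)), <- IH, <- psum_scal.
    apply psum_ext. intros i Hi. rewrite minus_INR by lia. ring. }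
  assert (HYW : 2 * Y = 2 * W + 1).
  { unfold Y. rewrite psum_head. simpl INR at 1.
    rewrite <- IH. unfold W. rewrite Rmult_plus_distr_l, <- !psum_scal, <- psum_plus.
    rewrite Rmult_0_l, Rmult_0_r, Rplus_0_l. apply psum_ext. intros i Hi.
    replace (S n - S i)%nat with (n - i)%nat by lia.
    rewrite hnat_S, S_INR. pose proof (pos_INR i). field. lra. }
  pose proof (pos_INR n). nra.
Qed.

(* Coefficients of [(1 - z)^(1/2)], the convolution inverse of [hnat]. *)
Definition sqrt_coef (i : nat) : R := match i with O => 1 | S q => - sqrt_tail q end.

(** As [(1 - z)^(1/2)] is [(1 - z)] times [(1 - z)^(-1/2)], this convolution is the difference of
    two consecutive values in [hnat_conv], that is [1 - 1]. *)
Lemma sqrt_coef_conv n :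
  psum (fun i => sqrt_coef i * hnat (n - i)) (S n) = match n with O => 1 | S _ => 0 end.
Proof.
  destruct n as [|n]; [simpl; rewrite hnat_0; ring|].
  rewrite psum_head. simpl sqrt_coef.
  pose proof (hnat_conv (S n)) as H1. pose proof (hnat_conv n) as H0.
  rewrite psum_head, hnat_0 in H1.
  enough (E : psum (fun i => - sqrt_tail i * hnat (S n - S i)) (S n) +
    psum (fun i => hnat i * hnat (n - i)) (S n) =
    psum (fun i => hnat (S i) * hnat (S n - S i)) (S n)) by lra.
  rewrite <- psum_plus. apply psum_ext. intros i Hi.
  replace (S n - S i)%nat with (n - i)%nat by lia. unfold sqrt_tail. ring.
Qed.

(** * The autocorrelation of [hnat] *)

(** The sum of [hnat i * hnat i] diverges, but the difference with shift 1 is dominated by the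
    telescoping [hnat i - hnat (S i)]. Only the positivity of [C0] matters later, not its value. *)
Lemma corr_series_ex : exists C0 : R,
  0 < C0 /\ is_series (fun i => hnat i * (hnat i - hnat (S i))) C0.
Proof.
  destruct (series_bounded (fun i => hnat i * (hnat i - hnat (S i))) 1) as [C0 [H _]].
  - intros i. pose proof (hnat_pos i). pose proof (hnat_le i 1). rewrite Nat.add_1_r in H0. nra.
  - intros n. apply Rle_trans with (psum (fun i => -1 * (hnat (S i) - hnat i)) n).
    + apply psum_le. intros i _. pose proof (hnat_pos i). pose proof (hnat_le1 i).
      pose proof (hnat_le i 1). rewrite Nat.add_1_r in H1. nra.
    + rewrite psum_scal, psum_telescope, hnat_0. pose proof (hnat_pos n). lra.
  - exists C0. split; [|exact H].
    apply Rlt_le_trans with (psum (fun i => hnat i * (hnat i - hnat (S i))) 1).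
    + simpl. rewrite hnat_S, hnat_0. simpl. lra.
    + apply psum_le_series; [|exact H].
      intros i. pose proof (hnat_pos i). pose proof (hnat_le i 1). rewrite Nat.add_1_r in H1. nra.
Qed.

(* Creative telescoping in [a], with certificate [- i hnat i hnat (i + a) / (i + a + 1)]. *)
Lemma corr_series (C0 : R) a :
  is_series (fun i => hnat i * (hnat i - hnat (S i))) C0 ->
  is_series (fun i => hnat i * (hnat (i + a) - hnat (S (i + a)))) (C0 / (2 * INR a + 1)).
Proof.
  intros H0. induction a as [|a IH].
  - apply is_series_eq with (3 := H0); [|simpl; field].
    intros i. now rewrite Nat.add_0_r.
  - set (R := fun i => - INR i * hnat i * hnat (i + a) / (INR (i + a) + 1)).
    assert (HR : is_series (fun i => R (S i) - R i) 0).
    { apply is_series_psum. apply is_lim_seq_ext with R.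
      - intros n. rewrite psum_telescope. unfold R. simpl (INR 0). field.
        pose proof (pos_INR (0 + a)). pose proof (pos_INR (n + a)). split; lra.
      - apply is_lim_seq_abs_0. apply is_lim_seq_le_le with (fun _ => 0) hnat.
        + intros n. split; [apply Rabs_pos|]. unfold R.
          pose proof (pos_INR n). pose proof (pos_INR a). pose proof (hnat_pos n).
          pose proof (hnat_pos (n + a)). pose proof (hnat_le1 (n + a)).
          rewrite plus_INR.
          replace (- INR n * hnat n * hnat (n + a) / (INR n + INR a + 1)) with
            (- (hnat n * (INR n * hnat (n + a) / (INR n + INR a + 1)))) by (field; lra).
          assert (0 <= INR n * hnat (n + a) / (INR n + INR a + 1) <= 1).
          { split.
            - apply Rdiv_le_0_compat; [|lra]. apply Rmult_le_pos; lra.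
            - apply Rle_div_l; nra. }
          rewrite Rabs_Ropp, Rabs_pos_eq; nra.
        + apply is_lim_seq_const.
        + apply is_lim_seq_hnat. }
    pose proof (pos_INR a) as Ha.
    pose proof (is_series_mult_l (/ (2 * INR a + 3)) _ _
      (is_series_add _ _ _ _ (is_series_mult_l (2 * INR a + 1) _ _ IH) HR)) as K.
    apply is_series_eq with (3 := K).
    + intros i. unfold R. rewrite Nat.add_succ_r. rewrite (Nat.add_succ_l i a).
      rewrite !hnat_S, !S_INR, plus_INR. pose proof (pos_INR i). field. lra.
    + rewrite S_INR. field. lra.
Qed.

Definition odd_harmonic (j : nat) : R := psum (fun i => 1 / (2 * INR i + 1)) j.

Lemma odd_harmonic_S j : odd_harmonic (S j) = odd_harmonic j + 1 / (2 * INR j + 1).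
Proof. reflexivity. Qed.

(** The autocorrelation at shift [d], truncated because the full sum diverges; only differences have
    a limit in [M]. *)
Definition corr (d : Z) (M : nat) : R :=
  psum (fun i => hnat i * hdown (Z.of_nat i + d)) M.

Lemma corr_lim_nat (C0 : R) a :
  is_series (fun i => hnat i * (hnat i - hnat (S i))) C0 ->
  is_lim_seq (fun M => corr 0 M - corr (Z.of_nat a) M) (C0 * odd_harmonic a).
Proof.
  intros H0. induction a as [|a IH].
  - unfold odd_harmonic. simpl psum. rewrite Rmult_0_r.
    apply is_lim_seq_ext with (fun _ => 0); [|apply is_lim_seq_const].
    intros n. simpl Z.of_nat. ring.
  - pose proof (proj1 (is_series_psum _ _) (corr_series C0 a H0)) as K.
    pose proof (is_lim_seq_plus' _ _ _ _ IH K) as L.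
    rewrite odd_harmonic_S. replace (C0 * (odd_harmonic a + 1 / (2 * INR a + 1))) with
      (C0 * odd_harmonic a + C0 / (2 * INR a + 1)) by (pose proof (pos_INR a); field; lra).
    apply is_lim_seq_ext with (2 := L). intros M.
    unfold corr. rewrite <- !psum_minus, <- psum_plus. apply psum_ext. intros i _.
    rewrite Z.add_0_r, <- !Nat2Z.inj_add, !hdown_nat, Nat.add_succ_r. ring.
Qed.

(** A bounded change of the truncation adds a fixed number of terms, each tending to 0. This makes
    the differing truncation points of reindexed sums harmless. *)
Lemma corr_shift_lim d u : is_lim_seq (fun M => corr d (M + u) - corr d M) 0.
Proof.
  induction u as [|u IH].
  - apply is_lim_seq_ext with (fun _ => 0); [|apply is_lim_seq_const].
    intros n. rewrite Nat.add_0_r. ring.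
  - assert (K : is_lim_seq (fun M => hnat (M + u) * hdown (Z.of_nat (M + u) + d)) 0).
    { apply is_lim_seq_le_le with (fun _ => 0) (fun M => hnat (M + u)).
      - intros n. pose proof (hnat_pos (n + u)).
        pose proof (hdown_bounds (Z.of_nat (n + u) + d)). nra.
      - apply is_lim_seq_const.
      - apply (is_lim_seq_incr_n hnat u), is_lim_seq_hnat. }
    pose proof (is_lim_seq_plus' _ _ _ _ IH K) as L. rewrite Rplus_0_r in L.
    apply is_lim_seq_ext with (2 := L). intros M. unfold corr.
    rewrite Nat.add_succ_r. simpl psum. ring.
Qed.

(** The first [a] terms vanish since [hdown] is zero on negative integers; the others match after
    shifting the index by [a]. *)
Lemma corr_neg a M : corr (- Z.of_nat a) (M + a) = corr (Z.of_nat a) M.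
Proof.
  unfold corr. rewrite Nat.add_comm, psum_split.
  rewrite psum_zero.
  - rewrite Rplus_0_l. apply psum_ext. intros i _.
    rewrite Nat2Z.inj_add. replace (Z.of_nat a + Z.of_nat i + - Z.of_nat a)%Z with (Z.of_nat i) by lia.
    rewrite <- !Nat2Z.inj_add, !hdown_nat. rewrite Nat.add_comm. ring.
  - intros i Hi. rewrite hdown_neg by lia. ring.
Qed.

Lemma corr_lim (C0 : R) d :
  is_series (fun i => hnat i * (hnat i - hnat (S i))) C0 ->
  is_lim_seq (fun M => corr 0 M - corr d M) (C0 * odd_harmonic (Z.abs_nat d)).
Proof.
  intros H0. destruct (Z.le_ge_cases 0 d) as [Hd|Hd].
  - pose proof (corr_lim_nat C0 (Z.abs_nat d) H0) as K.
    rewrite Nat2Z.inj_abs_nat, Z.abs_eq in K by lia. exact K.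
  - set (a := Z.abs_nat d). assert (E : d = (- Z.of_nat a)%Z) by lia.
    apply is_lim_seq_incr_n with a. rewrite E.
    pose proof (is_lim_seq_plus' _ _ _ _ (corr_lim_nat C0 a H0) (corr_shift_lim 0 a)) as L.
    rewrite Rplus_0_r in L. apply is_lim_seq_ext with (2 := L).
    intros M. rewrite corr_neg. ring.
Qed.

(** * Test sequences, kernel and remainder *)

Definition trunc_corr (m : nat) (j : Z) : R :=
  psum (fun i => hnat i * hdown (Z.of_nat i + j - Z.of_nat m)) m.

Definition test_seq (m i : nat) : R := hnat (i + m) - hdown (Z.of_nat i - Z.of_nat m).

Definition kernel (m : nat) (j : Z) : R :=
  odd_harmonic (Z.abs_nat (Z.of_nat m + j)) - odd_harmonic (Z.abs_nat (Z.of_nat m - j)).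

(** The products with [hnat (i + m)] form the autocorrelation at shift [j - m] without its first [m]
    terms, which are [trunc_corr m j]; those with [hdown (i - m)] form the one at shift [j + m]. The
    divergent parts cancel and [corr_lim] evaluates the difference. *)
Lemma test_seq_series (C0 : R) m j :
  is_series (fun i => hnat i * (hnat i - hnat (S i))) C0 ->
  is_series (fun i => test_seq m i * hdown (Z.of_nat i + j)) (C0 * kernel m j - trunc_corr m j).
Proof.
  intros H0. apply is_series_psum, is_lim_seq_incr_n with m.
  set (d1 := (j - Z.of_nat m)%Z). set (d2 := (Z.of_nat m + j)%Z).
  (* Reindexing puts the two truncations at [M + 2m] and [M]; the third bracket accounts for the
     mismatch and tends to 0. *)
  assert (E : forall M, psum (fun i => test_seq m i * hdown (Z.of_nat i + j)) (M + m) =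
     (corr 0 M - corr d2 M) - (corr 0 (M + (m + m)) - corr d1 (M + (m + m)))
     + (corr 0 (M + (m + m)) - corr 0 M) - trunc_corr m j).
  { intros M.
    transitivity (corr d1 (M + (m + m)) - trunc_corr m j - corr d2 M); [|ring].
    transitivity (psum (fun i => hnat (i + m) * hdown (Z.of_nat i + j)) (M + m) -
       psum (fun i => hdown (Z.of_nat i - Z.of_nat m) * hdown (Z.of_nat i + j)) (M + m)).
    { rewrite <- psum_minus. apply psum_ext. intros i _. unfold test_seq. ring. }
    f_equal.
    - assert (K : corr d1 (M + (m + m)) = trunc_corr m j +
        psum (fun i => hnat (i + m) * hdown (Z.of_nat i + j)) (M + m)).
      { unfold corr. replace (M + (m + m))%nat with (m + (M + m))%nat by lia.
        rewrite psum_split. f_equal; apply psum_ext; intros i _.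
        - unfold d1. do 2 f_equal. lia.
        - rewrite Nat.add_comm. unfold d1. do 2 f_equal. lia. }
      rewrite K. ring.
    - unfold corr. rewrite Nat.add_comm, psum_split, psum_zero.
      + rewrite Rplus_0_l. apply psum_ext. intros i _. unfold d2.
        replace (Z.of_nat (m + i) - Z.of_nat m)%Z with (Z.of_nat i) by lia.
        rewrite hdown_nat. do 2 f_equal. lia.
      + intros i Hi. rewrite hdown_neg by lia. ring. }
  apply is_lim_seq_ext with (1 := fun M => eq_sym (E M)).
  replace (C0 * kernel m j - trunc_corr m j) with
    (C0 * odd_harmonic (Z.abs_nat d2) - C0 * odd_harmonic (Z.abs_nat d1) + 0 - trunc_corr m j).
  - apply is_lim_seq_minus'; [|apply is_lim_seq_const].
    apply is_lim_seq_plus'; [|apply corr_shift_lim].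
    apply is_lim_seq_minus'; [now apply corr_lim|].
    apply (is_lim_seq_incr_n (fun M => corr 0 M - corr d1 M) (m + m)). now apply corr_lim.
  - unfold kernel. replace (Z.abs_nat (Z.of_nat m - j)) with (Z.abs_nat d1) by (unfold d1; lia).
    unfold d2. ring.
Qed.

(** Beyond index [m] the absolute values are [hnat k - hnat (k + 2m)], whose partial sums telescope
    to at most the first [2m] values of [hnat]. This justifies exchanging the test sum with the sum
    over [nu]. *)
Lemma test_seq_abs_summable m : ex_series (fun i => Rabs (test_seq m i)).
Proof.
  apply (ex_series_incr_n _ m).
  destruct (series_bounded (fun k => Rabs (test_seq m (m + k))) (psum hnat (m + m))) as [l [Hl _]];
    [intros; apply Rabs_pos | | now exists l].
  intros n.
  rewrite (psum_ext _ (fun k => hnat k - hnat (m + m + k))).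
  - rewrite psum_minus. pose proof (psum_split hnat (m + m) n).
    pose proof (psum_mono hnat n (m + m + n) (fun i => Rlt_le _ _ (hnat_pos i))).
    assert (psum hnat n <= psum hnat (m + m + n)) by (apply H0; lia). lra.
  - intros k _. unfold test_seq.
    replace (Z.of_nat (m + k) - Z.of_nat m)%Z with (Z.of_nat k) by lia. rewrite hdown_nat.
    replace (m + k + m)%nat with (m + m + k)%nat by lia.
    rewrite Rabs_minus_sym. apply Rabs_pos_eq.
    pose proof (hnat_le k (m + m)). rewrite Nat.add_comm in H. lra.
Qed.

Lemma trunc_corr_nonneg m j : 0 <= trunc_corr m j.
Proof.
  apply psum_nonneg. intros i _. pose proof (hnat_pos i).
  pose proof (hdown_bounds (Z.of_nat i + j - Z.of_nat m)). nra.
Qed.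

Lemma trunc_corr_nonpos m j : (j <= 0)%Z -> trunc_corr m j = 0.
Proof. intros Hj. apply psum_zero. intros i Hi. rewrite hdown_neg by lia. ring. Qed.

(** Substituting [i = m - 1 - q] makes the number of terms depend on [n] only, so that a sum over
    [m] can be taken term by term. The induction uses that both sides grow by [hnat m * hnat n] when
    [m] and [n] grow by one. *)
Lemma trunc_corr_alt m n :
  trunc_corr m (Z.of_nat n) =
  psum (fun q => hnat (n - 1 - q) * hdown (Z.of_nat m - 1 - Z.of_nat q)) n.
Proof.
  revert n. induction m as [|m IH]; intros n.
  - unfold trunc_corr. simpl psum at 1. symmetry. apply psum_zero. intros i _.
    rewrite hdown_neg by lia. ring.
  - destruct n as [|n]; [rewrite trunc_corr_nonpos by lia; reflexivity|].
    transitivity (trunc_corr m (Z.of_nat n) + hnat m * hnat n).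
    + unfold trunc_corr. cbn [psum].
      replace (Z.of_nat m + Z.of_nat (S n) - Z.of_nat (S m))%Z with (Z.of_nat n) by lia.
      rewrite hdown_nat. f_equal. apply psum_ext. intros i _. do 2 f_equal. lia.
    + rewrite psum_head, IH, Rplus_comm.
      replace (Z.of_nat (S m) - 1 - Z.of_nat 0)%Z with (Z.of_nat m) by lia.
      replace (S n - 1 - 0)%nat with n by lia. rewrite hdown_nat.
      rewrite (Rmult_comm (hnat m)). f_equal. apply psum_ext. intros i _.
      replace (S n - 1 - S i)%nat with (n - 1 - i)%nat by lia. do 2 f_equal. lia.
Qed.

(** * A beta integral in series form *)

(* [beta_weight r] is [Beta (r - 1 / 2, 2)]. *)
Definition beta_weight (r : R) : R := 1 / ((r - 1 / 2) * (r + 1 / 2)).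

Lemma beta_weight_pos r : 1 / 2 < r -> 0 < beta_weight r.
Proof. intros H. apply Rdiv_lt_0_compat; [lra|]. apply Rmult_lt_0_compat; lra. Qed.

(* Creative telescoping in [q], with certificate [- j hnat j beta_weight (q + 1 + j)]. *)
Lemma beta_series : exists c : R, 0 < c /\
  forall q, is_series (fun j => hnat j * beta_weight (INR q + 1 + INR j)) (c * sqrt_tail q).
Proof.
  assert (T : forall q j, 0 < hnat j * beta_weight (INR q + 1 + INR j)).
  { intros q j. pose proof (pos_INR q). pose proof (pos_INR j).
    apply Rmult_lt_0_compat; [apply hnat_pos | apply beta_weight_pos; lra]. }
  destruct (series_bounded (fun j => hnat j * beta_weight (INR 0 + 1 + INR j)) 2) as [T0 [H0 _]].
  - intros j. apply Rlt_le, T.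
  - intros n.
    apply Rle_trans with (psum (fun j => -1 * (1 / (INR (S j) + 1 / 2) - 1 / (INR j + 1 / 2))) n).
    + apply psum_le. intros j _. pose proof (hnat_le1 j). pose proof (hnat_pos j).
      pose proof (pos_INR j). rewrite S_INR. simpl INR.
      replace (-1 * (1 / (INR j + 1 + 1 / 2) - 1 / (INR j + 1 / 2))) with (beta_weight (0 + 1 + INR j))
        by (unfold beta_weight; field; lra).
      assert (0 < beta_weight (0 + 1 + INR j)) by (apply beta_weight_pos; lra). nra.
    + rewrite psum_scal, (psum_telescope (fun j => 1 / (INR j + 1 / 2))). pose proof (pos_INR n).
      assert (0 < 1 / (INR n + 1 / 2)) by (apply Rdiv_lt_0_compat; lra). simpl INR. lra.
  - assert (0 < T0).
    { apply Rlt_le_trans with (1 := T 0%nat 0%nat).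
      replace (hnat 0 * beta_weight (INR 0 + 1 + INR 0)) with
        (psum (fun j => hnat j * beta_weight (INR 0 + 1 + INR j)) 1) by (simpl; ring).
      apply psum_le_series; [intros; apply Rlt_le, T | exact H0]. }
    exists (T0 / sqrt_tail 0). pose proof (sqrt_tail_pos 0). split; [now apply Rdiv_lt_0_compat|].
    induction q as [|q IH].
    + apply is_series_eq with (3 := H0); [reflexivity | field; lra].
    + set (R := fun j => - INR j * hnat j * beta_weight (INR q + 1 + INR j)).
      pose proof (pos_INR q) as Hq.
      assert (HR : is_series (fun i => R (S i) - R i) 0).
      { apply is_series_psum. apply is_lim_seq_ext with R.
        - intros n. rewrite psum_telescope. unfold R. simpl (INR 0). ring.
        - apply is_lim_seq_abs_0.
          apply is_lim_seq_le_le with (fun _ => 0) (fun n => 2 * hnat n).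
          + intros n. split; [apply Rabs_pos|]. unfold R.
            pose proof (pos_INR n). pose proof (hnat_pos n).
            assert (0 < beta_weight (INR q + 1 + INR n)) by (apply beta_weight_pos; lra).
            assert (INR n * beta_weight (INR q + 1 + INR n) <= 2).
            { unfold beta_weight. replace (INR n * (1 / ((INR q + 1 + INR n - 1 / 2) * (INR q + 1 + INR n + 1 / 2))))
              with (INR n / ((INR q + 1 + INR n - 1 / 2) * (INR q + 1 + INR n + 1 / 2))) by (field; lra).
              apply Rle_div_l; nra. }
            replace (- INR n * hnat n * beta_weight (INR q + 1 + INR n)) with
              (- (hnat n * (INR n * beta_weight (INR q + 1 + INR n)))) by ring.
            rewrite Rabs_Ropp, Rabs_pos_eq; [nra|].
            apply Rmult_le_pos; [lra|]. apply Rmult_le_pos; lra.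
          + apply is_lim_seq_const.
          + replace (Finite 0) with (Finite (2 * 0)) by (f_equal; ring).
            apply is_lim_seq_mult'; [apply is_lim_seq_const | apply is_lim_seq_hnat]. }
      pose proof (is_series_mult_l (/ (INR q + 2)) _ _
        (is_series_add _ _ _ _ (is_series_mult_l (INR q + 1 / 2) _ _ IH) HR)) as K.
      apply is_series_eq with (3 := K).
      * intros j. unfold R, beta_weight. rewrite !hnat_S, !S_INR. pose proof (pos_INR j). field. lra.
      * rewrite sqrt_tail_S. field. lra.
Qed.

(** * The exact formula for [nu (- N)] *)

Lemma odd_harmonic_diff a d : 0 <= odd_harmonic (a + d) - odd_harmonic a <= INR d.
Proof.
  induction d as [|d IH]; [rewrite Nat.add_0_r; simpl; lra|].
  rewrite Nat.add_succ_r, odd_harmonic_S, S_INR. pose proof (pos_INR (a + d)).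
  assert (0 <= 1 / (2 * INR (a + d) + 1) <= 1); [|lra].
  split; [apply Rdiv_le_0_compat; lra | apply Rle_div_l; lra].
Qed.

(** The two arguments of [odd_harmonic] differ by [2 min(m, j)], and each increment of
    [odd_harmonic] is at most 1. *)
Lemma kernel_bounds m j :
  0 <= kernel m (Z.of_nat j) /\ kernel m (Z.of_nat j) <= 2 * INR m /\
  kernel m (Z.of_nat j) <= 2 * INR j.
Proof.
  unfold kernel. set (d := Z.abs_nat (Z.of_nat m - Z.of_nat j)).
  replace (Z.abs_nat (Z.of_nat m + Z.of_nat j)) with (d + 2 * Nat.min m j)%nat
    by (unfold d; lia).
  pose proof (odd_harmonic_diff d (2 * Nat.min m j)) as H. rewrite mult_INR in H. change (INR 2) with 2 in H.
  assert (INR (Nat.min m j) <= INR m) by (apply le_INR; lia).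
  assert (INR (Nat.min m j) <= INR j) by (apply le_INR; lia).
  lra.
Qed.

Lemma kernel_opp m j : kernel m (- j) = - kernel m j.
Proof. unfold kernel. rewrite Z.sub_opp_r, Z.add_opp_r. ring. Qed.

(** Pairing [n] with [- n - 1] folds a sum over the integers into one series over [nat]. *)
Definition zpair (nu : Z -> R) (p : Z) (n : nat) : R :=
  nu (Z.of_nat n) * hdown (p + Z.of_nat n) +
  nu (- Z.of_nat n - 1)%Z * hdown (p + (- Z.of_nat n - 1)).

Lemma zpair_series nu p :
  harmonic_on_pos nu hdown -> (1 <= p)%Z -> is_series (zpair nu p) (hdown p).
Proof.
  intros H Hp. destruct (H p Hp) as (a & b & Ha & Hb & ->).
  exact (is_series_add _ _ _ _ Ha Hb).
Qed.

Lemma prob_pair_series nu :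
  is_prob_Z nu -> is_series (fun n => nu (Z.of_nat n) + nu (- Z.of_nat n - 1)%Z) 1.
Proof. intros [_ (a & b & Ha & Hb & ->)]. now apply is_series_add. Qed.

Definition gap (nu : Z -> R) (n : nat) : R := nu (Z.of_nat n) - nu (- Z.of_nat n - 2)%Z.

(** Harmonicity at [p = i + 1] is multiplied by [test_seq m i] and summed over [i]. After the
    exchange, [nu k] carries the value of [test_seq_series] at shift [k + 1]. The kernel is odd in
    the shift, so negative [k] enter with a minus sign and without remainder; [v] collects the
    remainder of the nonnegative ones. *)
Lemma gap_kernel_series nu (C0 : R) m (v : R) :
  is_prob_Z nu -> harmonic_on_pos nu hdown ->
  is_series (fun i => hnat i * (hnat i - hnat (S i))) C0 ->
  is_series (fun n => nu (Z.of_nat n) * trunc_corr m (Z.of_nat (S n))) v ->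
  is_series (fun n => gap nu n * (C0 * kernel m (Z.of_nat (S n)))) (C0 * kernel m 1 - trunc_corr m 1 + v).
Proof.
  intros Hnu Hh0 HC0 Hv. pose proof (proj1 Hnu) as Hpos.
  assert (K : is_series (fun n => nu (Z.of_nat n) * (C0 * kernel m (Z.of_nat (S n)) - trunc_corr m (Z.of_nat (S n)))
     + nu (- Z.of_nat n - 1)%Z * (C0 * kernel m (- Z.of_nat n) - trunc_corr m (- Z.of_nat n)))
     (C0 * kernel m 1 - trunc_corr m 1)).
  { apply series_swap with
      (f := fun i n => test_seq m i * zpair nu (Z.of_nat i + 1) n)
      (F := fun i n => Rabs (test_seq m i) * (nu (Z.of_nat n) + nu (- Z.of_nat n - 1)%Z))
      (a := fun i => test_seq m i * hdown (Z.of_nat i + 1))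
      (r := fun i => Rabs (test_seq m i) * 1).
    - intros i n. rewrite Rabs_mult. apply Rmult_le_compat_l; [apply Rabs_pos|].
      unfold zpair. pose proof (Hpos (Z.of_nat n)). pose proof (Hpos (- Z.of_nat n - 1)%Z).
      pose proof (hdown_bounds (Z.of_nat i + 1 + Z.of_nat n)).
      pose proof (hdown_bounds (Z.of_nat i + 1 + (- Z.of_nat n - 1))).
      rewrite Rabs_pos_eq; nra.
    - intros i. apply is_series_mult_l. now apply prob_pair_series.
    - destruct (test_seq_abs_summable m) as [l Hl]. exists l.
      apply is_series_ext with (2 := Hl). intros n. symmetry. apply Rmult_1_r.
    - intros i. apply is_series_mult_l. apply zpair_series; [exact Hh0 | lia].
    - intros n.
      pose proof (is_series_add _ _ _ _
        (is_series_mult_l (nu (Z.of_nat n)) _ _ (test_seq_series C0 m (Z.of_nat (S n)) HC0))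
        (is_series_mult_l (nu (- Z.of_nat n - 1)%Z) _ _ (test_seq_series C0 m (- Z.of_nat n) HC0))) as L.
      apply is_series_eq with (3 := L); [|reflexivity].
      intros i. unfold zpair.
      replace (Z.of_nat i + 1 + Z.of_nat n)%Z with (Z.of_nat i + Z.of_nat (S n))%Z by lia.
      replace (Z.of_nat i + 1 + (- Z.of_nat n - 1))%Z with (Z.of_nat i + - Z.of_nat n)%Z by lia.
      ring.
    - now apply test_seq_series. }
  (* The negative part converges on its own because the kernel is bounded by [2 m]; it may therefore
     be separated and reindexed. *)
  assert (W : exists w : R, is_series (fun n => nu (- Z.of_nat n - 1)%Z * (C0 * kernel m (Z.of_nat n))) w).
  { assert (B : forall n, Rabs (nu (- Z.of_nat n - 1)%Z * (C0 * kernel m (Z.of_nat n))) <=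
      Rabs C0 * (2 * INR m) * nu (- Z.of_nat n - 1)%Z).
    { intros n. pose proof (Hpos (- Z.of_nat n - 1)%Z).
      destruct (kernel_bounds m n) as (K1 & K2 & _).
      rewrite !Rabs_mult, (Rabs_pos_eq (nu _)), (Rabs_pos_eq (kernel _ _)) by assumption.
      pose proof (Rabs_pos C0).
      apply Rle_trans with (nu (- Z.of_nat n - 1)%Z * (Rabs C0 * (2 * INR m))); [|lra].
      apply Rmult_le_compat_l; [assumption|]. now apply Rmult_le_compat_l. }
    destruct Hnu as [_ (a & b & _ & Hb & _)].
    destruct (series_dominated (fun n => nu (- Z.of_nat n - 1)%Z * (C0 * kernel m (Z.of_nat n)))
      _ _ (fun n => B n) (is_series_mult_l (Rabs C0 * (2 * INR m)) _ _ Hb)) as [w [Hw _]].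
    now exists w. }
  destruct W as [w Hw].
  (* The dropped term is zero since [kernel m 0 = 0]. The shift by one makes [nu (- n - 2)] face
     [kernel m (n + 1)], as [nu n] does, which produces [gap nu n]. *)
  pose proof (proj1 (is_series_drop _ _ 1) Hw) as Hw1.
  pose proof (is_series_sub _ _ _ _
    (is_series_add _ _ _ _ (is_series_add _ _ _ _ K Hv) Hw) Hw1) as L.
  apply is_series_eq with (3 := L).
  - intros n. rewrite kernel_opp, (trunc_corr_nonpos m (- Z.of_nat n)) by lia. unfold gap.
    replace (- Z.of_nat (1 + n) - 1)%Z with (- Z.of_nat n - 2)%Z by lia.
    simpl (1 + n)%nat. ring.
  - simpl psum. replace (kernel m 0) with 0; [ring|].
    unfold kernel. rewrite Z.add_0_r, Z.sub_0_r. ring.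
Qed.

(** * Deconvolution by [(1 - z)^(1/2)] *)

Definition sqrt_conv (q n : nat) : R := psum (fun i => sqrt_tail (q + i) * hnat (n - i)) (S n).

(** The relations at [p = q + 1 - i], for [i] from 0 to [q], are combined with the coefficients
    [sqrt_coef i]. As [sqrt_coef] inverts [hnat], a single negative position survives, namely
    [- (q + 1)]. *)
Lemma harmonic_deconvolved nu q :
  harmonic_on_pos nu hdown ->
  is_series (fun n => nu (Z.of_nat n) * sqrt_conv q n) (sqrt_tail q - nu (- Z.of_nat (S q))%Z).
Proof.
  intros H.
  assert (K : is_series (fun n => psum (fun i => sqrt_coef i * zpair nu (Z.of_nat (S q) - Z.of_nat i) n) (S q))
     (psum (fun i => sqrt_coef i * hdown (Z.of_nat (S q) - Z.of_nat i)) (S q))).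
  { apply (is_series_lsum (fun i n => sqrt_coef i * zpair nu (Z.of_nat (S q) - Z.of_nat i) n)).
    intros i Hi. apply is_series_mult_l. apply zpair_series; [exact H | lia]. }
  set (D := fun n => if Nat.eqb n q then nu (- Z.of_nat (S q))%Z else 0).
  assert (HD : is_series D (nu (- Z.of_nat (S q))%Z)).
  { apply is_series_eq with (f := D) (l := psum D (S q)); [reflexivity | |].
    - cbn [psum]. rewrite psum_zero.
      + unfold D. rewrite Nat.eqb_refl. ring.
      + intros i Hi. unfold D. destruct (Nat.eqb_spec i q); [lia | reflexivity].
    - apply is_series_finite. intros i Hi. unfold D.
      destruct (Nat.eqb_spec i q); [lia | reflexivity]. }
  apply is_series_eq with (3 := is_series_sub _ _ _ _ K HD).
  - intros n.
    (* The complete convolution at [q + 1 + n] is zero; its first [q + 1] terms are minus the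
       remaining [n + 1], which are those of [- sqrt_conv q n]. *)
    assert (E1 : psum (fun i => sqrt_coef i * hdown (Z.of_nat (S q) - Z.of_nat i + Z.of_nat n)) (S q) = sqrt_conv q n).
    { pose proof (sqrt_coef_conv (S q + n)) as A. simpl (S q + n)%nat in A. cbv iota in A.
      replace (S (S (q + n))) with (S q + S n)%nat in A by lia.
      rewrite psum_split in A.
      transitivity (psum (fun i => sqrt_coef i * hnat (S (q + n) - i)) (S q)).
      - apply psum_ext. intros i Hi.
        replace (Z.of_nat (S q) - Z.of_nat i + Z.of_nat n)%Z with (Z.of_nat (S (q + n) - i)) by lia.
        now rewrite hdown_nat.
      - enough (sqrt_conv q n = - psum (fun i => sqrt_coef (S q + i) * hnat (S (q + n) - (S q + i))) (S n)) by lra.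
        replace (- psum (fun i => sqrt_coef (S q + i) * hnat (S (q + n) - (S q + i))) (S n)) with
          (-1 * psum (fun i => sqrt_coef (S q + i) * hnat (S (q + n) - (S q + i))) (S n)) by ring.
        rewrite <- psum_scal. apply psum_ext. intros i Hi.
        replace (S (q + n) - (S q + i))%nat with (n - i)%nat by lia. simpl. ring. }
    (* Here the convolution at [q - n] is complete, so it is 1 if [n = q] and 0 if [n < q]; for
       [n > q] all arguments of [hdown] are negative. *)
    assert (E2 : nu (- Z.of_nat n - 1)%Z *
       psum (fun i => sqrt_coef i * hdown (Z.of_nat (S q) - Z.of_nat i + (- Z.of_nat n - 1))) (S q) = D n).
    { unfold D. destruct (Nat.le_gt_cases n q) as [Hn|Hn].
      - replace (psum (fun i => sqrt_coef i * hdown (Z.of_nat (S q) - Z.of_nat i + (- Z.of_nat n - 1))) (S q))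
          with (match (q - n)%nat with O => 1 | S _ => 0 end).
        + destruct (Nat.eqb_spec n q) as [->|E].
          * rewrite Nat.sub_diag, Rmult_1_r. f_equal. lia.
          * destruct (q - n)%nat eqn:E'; [lia | ring].
        + rewrite <- sqrt_coef_conv.
          set (f := fun i => sqrt_coef i * hdown (Z.of_nat (S q) - Z.of_nat i + (- Z.of_nat n - 1))).
          replace (psum f (S q)) with (psum f (S (q - n) + n)) by (f_equal; lia).
          unfold f. rewrite psum_split, (psum_zero _ n), Rplus_0_r.
          * apply psum_ext. intros i Hi.
            replace (Z.of_nat (S q) - Z.of_nat i + (- Z.of_nat n - 1))%Z
              with (Z.of_nat (q - n - i)) by lia.
            now rewrite hdown_nat.
          * intros i Hi. rewrite hdown_neg by lia. ring.
      - rewrite psum_zero, Rmult_0_r.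
        + destruct (Nat.eqb_spec n q); [lia | reflexivity].
        + intros i Hi. rewrite hdown_neg by lia. ring. }
    rewrite <- E2, <- E1, <- !psum_scal, <- psum_minus. apply psum_ext. intros i _.
    unfold zpair. ring.
  - f_equal. pose proof (sqrt_coef_conv (S q)) as A. cbv iota in A.
    change (psum (fun i => sqrt_coef i * hnat (S q - i)) (S q) + - sqrt_tail q * hnat (S q - S q) = 0) in A.
    rewrite Nat.sub_diag, hnat_0 in A.
    rewrite (psum_ext _ (fun i => sqrt_coef i * hnat (S q - i))); [lra|].
    intros i Hi. replace (Z.of_nat (S q) - Z.of_nat i)%Z with (Z.of_nat (S q - i)) by lia.
    now rewrite hdown_nat.
Qed.

(** In the form [trunc_corr_alt], the index [m] occurs only in [hdown (m - i)], with [i] of finite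
    range. Summing against the beta weights turns each such factor into [c * sqrt_tail (q + i)],
    hence the remainder into the coefficient of [harmonic_deconvolved]. *)
Lemma trunc_corr_mix_series (c : R) q n :
  (forall q, is_series (fun j => hnat j * beta_weight (INR q + 1 + INR j)) (c * sqrt_tail q)) ->
  is_series (fun m => beta_weight (INR (S q) + INR m) * trunc_corr (S m) (Z.of_nat (S n))) (c * sqrt_conv q n).
Proof.
  intros Hc.
  assert (K : forall i, is_series (fun m => beta_weight (INR (S q) + INR m) * hdown (Z.of_nat m - Z.of_nat i))
     (c * sqrt_tail (q + i))).
  { intros i. apply (is_series_drop _ _ i). apply is_series_eq with (3 := Hc (q + i)%nat).
    - intros j. replace (Z.of_nat (i + j) - Z.of_nat i)%Z with (Z.of_nat j) by lia.
      rewrite hdown_nat, S_INR, !plus_INR, Rmult_comm. f_equal. f_equal. ring.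
    - rewrite psum_zero; [ring|]. intros j Hj. rewrite hdown_neg by lia. ring. }
  pose proof (is_series_lsum (fun i m => hnat (n - i) *
    (beta_weight (INR (S q) + INR m) * hdown (Z.of_nat m - Z.of_nat i))) _ (S n)
    (fun i _ => is_series_mult_l (hnat (n - i)) _ _ (K i))) as L.
  apply is_series_eq with (3 := L).
  - intros m. rewrite trunc_corr_alt, <- psum_scal. apply psum_ext. intros i Hi.
    replace (S n - 1 - i)%nat with (n - i)%nat by lia.
    replace (Z.of_nat (S m) - 1 - Z.of_nat i)%Z with (Z.of_nat m - Z.of_nat i)%Z by lia. ring.
  - unfold sqrt_conv. rewrite <- psum_scal. apply psum_ext. intros. ring.
Qed.

(** * The averaged kernel *)

Definition weight_norm (x : R) : R := (x - 3 / 2) * (x - 1 / 2).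

(* The weights and kernels of a sum over [m >= 1] are indexed by [m - 1]. *)
Definition weight (x : R) (m : nat) : R := weight_norm x * beta_weight (x + INR m).

Definition phi (x : R) (j : nat) : R :=
  Series (fun m => weight x m * kernel (S m) (Z.of_nat j)).

Lemma weight_norm_pos x : 2 <= x -> 0 < weight_norm x.
Proof. intros H. unfold weight_norm. apply Rmult_lt_0_compat; lra. Qed.

Lemma weight_pos x m : 2 <= x -> 0 < weight x m.
Proof.
  intros H. pose proof (pos_INR m).
  apply Rmult_lt_0_compat; [now apply weight_norm_pos | apply beta_weight_pos; lra].
Qed.

Lemma weight_summable x : 2 <= x -> ex_series (weight x).
Proof.
  intros H.
  destruct (series_bounded (weight x) (weight_norm x / (x - 1 / 2))) as [l [Hl _]];
    [intros; apply Rlt_le; now apply weight_pos | | now exists l].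
  intros n.
  rewrite (psum_ext _ (fun m => - weight_norm x * (1 / (x + INR (S m) - 1 / 2) - 1 / (x + INR m - 1 / 2)))).
  - rewrite psum_scal, (psum_telescope (fun m => 1 / (x + INR m - 1 / 2))).
    pose proof (weight_norm_pos x H). pose proof (pos_INR n).
    assert (0 < 1 / (x + INR n - 1 / 2)) by (apply Rdiv_lt_0_compat; lra). simpl INR.
    replace (weight_norm x / (x - 1 / 2)) with (weight_norm x * (1 / (x + 0 - 1 / 2))) by (field; lra). nra.
  - intros m _. unfold weight, beta_weight. pose proof (pos_INR m). rewrite S_INR. field. lra.
Qed.

Lemma phi_series x j :
  2 <= x -> is_series (fun m => weight x m * kernel (S m) (Z.of_nat j)) (phi x j).
Proof.
  intros H. apply ex_series_is. pose proof (ex_series_is _ (weight_summable x H)) as K.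
  assert (B : forall m, Rabs (weight x m * kernel (S m) (Z.of_nat j)) <= 2 * INR j * weight x m).
  { intros m. destruct (kernel_bounds (S m) j) as (K1 & _ & K2).
    pose proof (weight_pos x m H). rewrite Rabs_pos_eq; nra. }
  destruct (series_dominated _ _ _ B (is_series_mult_l (2 * INR j) _ _ K)) as [a [Ha _]].
  now exists a.
Qed.

(** The identities of [gap_kernel_series] are averaged over [m] with the weights. The averaged
    remainder is the series of [harmonic_deconvolved], which brings in [nu (- N)]. All families are
    nonnegative, so Tonelli's theorem permits both exchanges. *)
Lemma exact_formula nu :
  is_prob_Z nu -> harmonic_on_pos nu hdown -> (forall n, 0 <= gap nu n) ->
  exists c : R, 0 < c /\ forall N, (2 <= N)%nat ->
    is_series (fun n => gap nu n * phi (INR N) (S n))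
      (phi (INR N) 1 - c * (weight_norm (INR N) * nu (- Z.of_nat N)%Z)).
Proof.
  intros Hnu Hh0 Hg. pose proof (proj1 Hnu) as Hpos.
  destruct corr_series_ex as (C0 & HC0 & HC0s). destruct beta_series as (c & Hc & Hcs).
  exists (c / C0). split; [now apply Rdiv_lt_0_compat|].
  (* With [N = q + 1], the deconvolution at [q] isolates [nu (- N)]. *)
  intros [|q] HN; [lia|]. set (x := INR (S q)).
  assert (Hx : 2 <= x) by (apply (le_INR 2); exact HN).
  pose proof (weight_norm_pos x Hx) as Hnorm.
  (* First exchange: [v m] is the remainder for the test index [m + 1], including its beta
     weight. *)
  destruct (series_swap_nonneg
    (fun n m => nu (Z.of_nat n) * (beta_weight (x + INR m) * trunc_corr (S m) (Z.of_nat (S n))))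
    (fun n => nu (Z.of_nat n) * (c * sqrt_conv q n)) (c * (sqrt_tail q - nu (- Z.of_nat (S q))%Z)))
    as (v & Hv & Hvs).
  { intros n m. pose proof (pos_INR m). apply Rmult_le_pos; [apply Hpos|].
    apply Rmult_le_pos; [apply Rlt_le, beta_weight_pos; lra | apply trunc_corr_nonneg]. }
  { intros n. apply is_series_mult_l. now apply trunc_corr_mix_series. }
  { apply is_series_eq with (3 := is_series_mult_l c _ _ (harmonic_deconvolved nu q Hh0));
      [intros; ring | reflexivity]. }
  assert (T : forall m, 0 < beta_weight (x + INR m)).
  { intros m. pose proof (pos_INR m). apply beta_weight_pos. lra. }
  assert (E : forall m, is_series (fun n => weight x m * gap nu n * (C0 * kernel (S m) (Z.of_nat (S n))))
     (C0 * (weight x m * kernel (S m) 1) - weight_norm x * (beta_weight (x + INR m) * trunc_corr (S m) 1) + weight_norm x * v m)).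
  { intros m. pose proof (T m) as Tm.
    pose proof (is_series_mult_l (/ beta_weight (x + INR m)) _ _ (Hv m)) as K.
    assert (K' : is_series (fun n => nu (Z.of_nat n) * trunc_corr (S m) (Z.of_nat (S n)))
       (/ beta_weight (x + INR m) * v m)).
    { apply is_series_eq with (3 := K); [|reflexivity]. intros n. field. lra. }
    pose proof (is_series_mult_l (weight x m) _ _ (gap_kernel_series nu C0 (S m) _ Hnu Hh0 HC0s K')) as L.
    apply is_series_eq with (3 := L); [intros; ring|]. unfold weight. field. lra. }
  assert (B : forall m n, 0 <= weight x m * gap nu n * (C0 * kernel (S m) (Z.of_nat (S n)))).
  { intros m n. pose proof (weight_pos x m Hx). destruct (kernel_bounds (S m) (S n)) as (K1 & _).
    apply Rmult_le_pos; [apply Rmult_le_pos; [lra | apply Hg]|].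
    apply Rmult_le_pos; [lra | exact K1]. }
  destruct (series_swap_nonneg _ _ (C0 * phi x 1 - weight_norm x * (c * sqrt_conv q 0) +
     weight_norm x * (c * (sqrt_tail q - nu (- Z.of_nat (S q))%Z))) B E) as (d & Hd & Hds).
  { apply is_series_add; [apply is_series_sub|]; apply is_series_mult_l.
    - exact (phi_series x 1 Hx).
    - exact (trunc_corr_mix_series c q 0 Hcs).
    - exact Hvs. }
  apply is_series_eq with (3 := is_series_mult_l (/ C0) _ _ Hds).
  - intros n. replace (d n) with (gap nu n * C0 * phi x (S n)); [field; lra|].
    apply is_series_uniq with (2 := Hd n).
    apply is_series_eq with (3 := is_series_mult_l (gap nu n * C0) _ _ (phi_series x (S n) Hx));
      [intros; ring | reflexivity].
  (* As [sqrt_conv q 0 = sqrt_tail q], the two tails cancel and only the term with [nu (- N)] is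
     left. *)
  - unfold sqrt_conv. cbn [psum]. rewrite Nat.add_0_r, Nat.sub_0_r, hnat_0. field. lra.
Qed.

(** * Asymptotics of the kernel *)

Lemma ln_le_minus1 y : 0 < y -> ln y <= y - 1.
Proof.
  intros H. rewrite <- (ln_exp (y - 1)). apply ln_le; [exact H|].
  pose proof (exp_ineq1_le (y - 1)). lra.
Qed.

Lemma ln_S_bounds n :
  1 / (INR n + 2) <= ln (INR n + 2) - ln (INR n + 1) <= 1 / (INR n + 1).
Proof.
  pose proof (pos_INR n) as Hn. split.
  - assert (0 < (INR n + 1) / (INR n + 2)) by (apply Rdiv_lt_0_compat; lra).
    pose proof (ln_le_minus1 _ H) as K. rewrite ln_div in K by lra.
    replace ((INR n + 1) / (INR n + 2) - 1) with (- (1 / (INR n + 2))) in K by (field; lra). lra.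
  - assert (0 < (INR n + 2) / (INR n + 1)) by (apply Rdiv_lt_0_compat; lra).
    pose proof (ln_le_minus1 _ H) as K. rewrite ln_div in K by lra.
    replace ((INR n + 2) / (INR n + 1) - 1) with (1 / (INR n + 1)) in K by (field; lra). lra.
Qed.

Lemma kernel_one m : kernel (S m) 1 = 1 / (2 * INR m + 1) + 1 / (2 * INR m + 3).
Proof.
  unfold kernel. replace (Z.abs_nat (Z.of_nat (S m) + 1)) with (S (S m)) by lia.
  replace (Z.abs_nat (Z.of_nat (S m) - 1)) with m by lia.
  rewrite !odd_harmonic_S, S_INR. pose proof (pos_INR m). field. lra.
Qed.

(** The two fractions of [kernel_one] surround [1 / (m + 1)]; the excess is bounded by a telescoping
    quantity so that it sums to a constant. *)
Lemma kernel_one_bounds m :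
  1 / (INR m + 1) <= kernel (S m) 1 <=
  1 / (INR m + 1) + 1 / 2 * (1 / (2 * INR m + 1) - 1 / (2 * INR (S m) + 1)).
Proof.
  rewrite kernel_one, S_INR. pose proof (pos_INR m) as H. set (y := INR m) in *. split.
  - apply Rminus_le_0.
    replace (1 / (2 * y + 1) + 1 / (2 * y + 3) - 1 / (y + 1)) with
      (1 / ((2 * y + 1) * (2 * y + 3) * (y + 1))) by (field; lra).
    apply Rdiv_le_0_compat; [lra|]. repeat apply Rmult_lt_0_compat; lra.
  - apply Rminus_le_0.
    replace (1 / (y + 1) + 1 / 2 * (1 / (2 * y + 1) - 1 / (2 * (y + 1) + 1)) -
      (1 / (2 * y + 1) + 1 / (2 * y + 3))) with
      (y / ((2 * y + 1) * (2 * y + 3) * (y + 1))) by (field; lra).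
    apply Rdiv_le_0_compat; [lra|]. repeat apply Rmult_lt_0_compat; lra.
Qed.

Lemma kernel_one_le m : kernel (S m) 1 <= 2 / (INR m + 1).
Proof.
  rewrite kernel_one. pose proof (pos_INR m) as H. set (y := INR m) in *.
  apply Rminus_le_0.
  replace (2 / (y + 1) - (1 / (2 * y + 1) + 1 / (2 * y + 3))) with
    ((4 * y * y + 8 * y + 2) / ((2 * y + 1) * (2 * y + 3) * (y + 1))) by (field; lra).
  apply Rdiv_le_0_compat; [nra|]. repeat apply Rmult_lt_0_compat; lra.
Qed.

Lemma psum_kernel_one_bounds n :
  ln (INR (S n) + 1) <= psum (fun m => kernel (S m) 1) (S n) <= 2 + ln (INR (S n)).
Proof.
  split.
  - induction n as [|n IH].
    + simpl psum. pose proof (kernel_one_bounds 0) as [H _]. pose proof (ln_S_bounds 0) as [_ K].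
      simpl INR in *. replace (0 + 1) with 1 in * by ring. rewrite ln_1 in K. replace (0 + 2) with (1 + 1) in K by ring. lra.
    + change (psum (fun m => kernel (S m) 1) (S (S n))) with
        (psum (fun m => kernel (S m) 1) (S n) + kernel (S (S n)) 1).
      pose proof (kernel_one_bounds (S n)) as [H _]. pose proof (ln_S_bounds (S n)) as [_ K].
      rewrite (S_INR (S n)) at 1. replace (INR (S n) + 1 + 1) with (INR (S n) + 2) by ring. lra.
  (* Strengthened by the telescoped excess, so that the induction closes. *)
  - enough (psum (fun m => kernel (S m) 1) (S n) <=
      1 + ln (INR (S n)) + 1 / 2 * (1 - 1 / (2 * INR (S n) + 1))).
    { pose proof (pos_INR (S n)).
      assert (0 < 1 / (2 * INR (S n) + 1)) by (apply Rdiv_lt_0_compat; lra). lra. }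
    induction n as [|n IH].
    + simpl psum. rewrite kernel_one. simpl INR. rewrite ln_1. lra.
    + change (psum (fun m => kernel (S m) 1) (S (S n))) with
        (psum (fun m => kernel (S m) 1) (S n) + kernel (S (S n)) 1).
      pose proof (kernel_one_bounds (S n)) as [_ H]. pose proof (ln_S_bounds n) as [K _].
      rewrite (S_INR (S n)) at 1. rewrite (S_INR n) in *.
      replace (INR n + 1 + 1) with (INR n + 2) in * by ring. lra.
Qed.

Lemma frac_bounds u v M :
  0 < u -> u <= v -> 0 < M ->
  0 < u / (u + M) <= v / (v + M) /\ v / (v + M) <= 1 /\ 1 - u / (u + M) <= M / (u + M).
Proof.
  intros. split; [split|split].
  - apply Rdiv_lt_0_compat; lra.
  - apply Rminus_le_0.
    replace (v / (v + M) - u / (u + M)) with (M * (v - u) / ((v + M) * (u + M))) by (field; lra).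
    apply Rdiv_le_0_compat; [nra|]. apply Rmult_lt_0_compat; lra.
  - apply Rle_div_l; lra.
  - right. field. lra.
Qed.

(** Both factors have the form [u / (u + M)] with [M = m + 1]; by [frac_bounds] they lie below 1 and
    increase with [x]. *)
Lemma weight_eq x m : 2 <= x ->
  weight x m = (x - 3 / 2) / (x - 3 / 2 + (INR m + 1)) * ((x - 1 / 2) / (x - 1 / 2 + (INR m + 1))).
Proof. intros H. unfold weight, weight_norm, beta_weight. pose proof (pos_INR m). field. lra. Qed.

Lemma weight_mono x y m : 2 <= x -> x <= y -> weight x m <= weight y m.
Proof.
  intros Hx Hy. rewrite !weight_eq by lra. pose proof (pos_INR m).
  destruct (frac_bounds (x - 3 / 2) (y - 3 / 2) (INR m + 1)) as (H1 & _); try lra.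
  destruct (frac_bounds (x - 1 / 2) (y - 1 / 2) (INR m + 1)) as (H2 & _); try lra.
  apply Rmult_le_compat; lra.
Qed.

Lemma weight_le1 x m : 2 <= x -> weight x m <= 1.
Proof.
  intros Hx. rewrite !weight_eq by lra. pose proof (pos_INR m).
  destruct (frac_bounds (x - 3 / 2) (x - 3 / 2) (INR m + 1)) as (H1 & K1 & _); try lra.
  destruct (frac_bounds (x - 1 / 2) (x - 1 / 2) (INR m + 1)) as (H2 & K2 & _); try lra.
  nra.
Qed.

Lemma weight_near1 x m : 2 <= x -> 1 - weight x m <= 3 * (INR m + 1) / x.
Proof.
  intros Hx. rewrite weight_eq by lra. pose proof (pos_INR m).
  destruct (frac_bounds (x - 3 / 2) (x - 3 / 2) (INR m + 1)) as (H1 & K1 & L1); try lra.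
  destruct (frac_bounds (x - 1 / 2) (x - 1 / 2) (INR m + 1)) as (H2 & K2 & L2); try lra.
  set (M := INR m + 1) in *.
  assert (J1 : M / (x - 3 / 2 + M) <= 3 / 2 * (M / x)).
  { replace (3 / 2 * (M / x)) with (M * / (2 / 3 * x)) by (field; lra).
    apply Rmult_le_compat_l; [unfold M; lra|]. apply Rinv_le_contravar; unfold M in *; lra. }
  assert (J2 : M / (x - 1 / 2 + M) <= M / x).
  { apply Rmult_le_compat_l; [unfold M; lra|]. apply Rinv_le_contravar; unfold M in *; lra. }
  assert (0 <= M / x) by (apply Rdiv_le_0_compat; unfold M in *; lra).
  replace (3 * M / x) with (3 * (M / x)) by (field; lra). nra.
Qed.

Lemma weight_decay x m : 2 <= x -> weight x m <= x * x / ((INR m + 1) * (INR m + 1)).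
Proof.
  intros Hx. unfold weight, weight_norm, beta_weight. pose proof (pos_INR m) as Hm.
  replace ((x - 3 / 2) * (x - 1 / 2) * (1 / ((x + INR m - 1 / 2) * (x + INR m + 1 / 2)))) with
    ((x - 3 / 2) * (x - 1 / 2) * / ((x + INR m - 1 / 2) * (x + INR m + 1 / 2))) by (field; lra).
  apply Rmult_le_compat; [nra | | nra |].
  - apply Rlt_le, Rinv_0_lt_compat. nra.
  - apply Rinv_le_contravar; nra.
Qed.

Lemma inv_consecutive_series n : (1 <= n)%nat ->
  is_series (fun i => 1 / (INR (n + i) * (INR (n + i) + 1))) (1 / INR n).
Proof.
  intros Hn. apply is_series_psum.
  assert (Hn' : 1 <= INR n) by (apply (le_INR 1); exact Hn).
  apply is_lim_seq_ext with (fun N => 1 / INR n - / INR (N + n)).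
  - intros N.
    rewrite (psum_ext _ (fun i => -1 * (1 / INR (n + S i) - 1 / INR (n + i)))).
    + rewrite psum_scal, (psum_telescope (fun i => 1 / INR (n + i))), Nat.add_0_r.
      rewrite (Nat.add_comm N). rewrite plus_INR. pose proof (pos_INR N). field. lra.
    + intros i _. rewrite Nat.add_succ_r, S_INR, plus_INR. pose proof (pos_INR i). field. lra.
  - replace (Finite (1 / INR n)) with (Finite (1 / INR n - 0)) by (f_equal; ring).
    apply is_lim_seq_minus'; [apply is_lim_seq_const|].
    apply (is_lim_seq_incr_n (fun N => / INR N) n).
    apply (is_lim_seq_inv INR p_infty); [apply is_lim_seq_INR | discriminate].
Qed.

(** Comparison with the telescoping series of [inv_consecutive_series]: a tail of inverse cubes past
    [n] is at most [1 / n^2]. *)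
Lemma inv_cube_le n i : (1 <= n)%nat ->
  1 / ((INR (n + i) + 1) * ((INR (n + i) + 1) * (INR (n + i) + 1))) <=
  1 / INR n * (1 / (INR (n + i) * (INR (n + i) + 1))).
Proof.
  intros Hn. assert (Hn' : 1 <= INR n) by (apply (le_INR 1); exact Hn).
  rewrite plus_INR. pose proof (pos_INR i) as Hi. set (a := INR n) in *. set (b := INR i) in *.
  replace (1 / a * (1 / ((a + b) * (a + b + 1)))) with (1 / (a * ((a + b) * (a + b + 1)))) by (field; lra).
  apply Rmult_le_compat_l; [lra|]. apply Rinv_le_contravar.
  - repeat apply Rmult_lt_0_compat; lra.
  - apply Rmult_le_compat; [lra | | lra | apply Rmult_le_compat; lra].
    apply Rmult_le_pos; lra.
Qed.

(** The sum is cut at [n], the integer part of [x]. Below [n], replacing the weight by 1 costs at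
    most [6 / x] per term, hence 6 in all; beyond [n], the weight decays like [x^2 / m^2] and the
    tail is at most 5. The partial sums of the kernel are logarithmic by [psum_kernel_one_bounds],
    up to 2. *)
Lemma phi_one_ln x : 2 <= x -> Rabs (phi x 1 - ln x) <= 7.
Proof.
  intros Hx. destruct (nfloor_ex x ltac:(lra)) as [n [H1 H2]].
  assert (Hn : (2 <= n)%nat).
  { destruct n as [|[|n]]; [simpl in H2; lra | simpl in H2; lra | lia]. }
  assert (Hn' : 2 <= INR n) by (apply (le_INR 2); exact Hn).
  destruct n as [|n']; [lia|]. set (n := S n') in *.
  pose proof (psum_kernel_one_bounds n') as [K1 K2]. fold n in K1, K2.
  pose proof (phi_series x 1 Hx) as HS. simpl Z.of_nat in HS.
  assert (T0 : forall m, 0 <= weight x m * kernel (S m) 1).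
  { intros m. pose proof (weight_pos x m Hx). destruct (kernel_bounds (S m) 1) as (K & _).
    simpl Z.of_nat in K. nra. }
  assert (L1 : ln (INR n) <= ln x) by (apply ln_le; lra).
  assert (L2 : ln x <= ln (INR n + 1)) by (apply ln_le; lra).
  apply Rabs_le. split.
  - pose proof (psum_le_series _ _ n T0 HS) as P.
    assert (Q : psum (fun m => kernel (S m) 1 - 6 / x) n <= psum (fun m => weight x m * kernel (S m) 1) n).
    { apply psum_le. intros m _. pose proof (weight_near1 x m Hx). pose proof (weight_le1 x m Hx).
      pose proof (kernel_one_le m). pose proof (pos_INR m).
      destruct (kernel_bounds (S m) 1) as (K & _). simpl Z.of_nat in K.
      assert (P3 : (1 - weight x m) * kernel (S m) 1 <= 3 * (INR m + 1) / x * (2 / (INR m + 1)))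
        by (apply Rmult_le_compat; lra).
      replace (3 * (INR m + 1) / x * (2 / (INR m + 1))) with (6 / x) in P3 by (field; lra). lra. }
    rewrite psum_minus in Q.
    assert (E : psum (fun _ => 6 / x) n <= 6).
    { clearbody n. replace (psum (fun _ => 6 / x) n) with (INR n * (6 / x)).
      - replace (INR n * (6 / x)) with (6 * (INR n / x)) by (field; lra).
        assert (INR n / x <= 1) by (apply Rle_div_l; lra). lra.
      - clear. induction n as [|n IH]; [simpl; ring|]. rewrite S_INR. simpl psum. rewrite <- IH. ring. }
    lra.
  - pose proof (proj1 (is_series_drop _ _ n) HS) as HT.
    assert (P : phi x 1 - psum (fun m => weight x m * kernel (S m) 1) n <=
       2 * (x * x) * (1 / INR n) * (1 / INR n)).
    { apply series_le with (2 := HT)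
        (3 := is_series_mult_l (2 * (x * x) * (1 / INR n)) _ _ (inv_consecutive_series n ltac:(lia))).
      intros i. cbv beta. pose proof (weight_decay x (n + i) Hx) as B1. pose proof (kernel_one_le (n + i)) as B2.
      pose proof (weight_pos x (n + i) Hx). destruct (kernel_bounds (S (n + i)) 1) as (K & _).
      simpl Z.of_nat in K. pose proof (inv_cube_le n i ltac:(lia)) as B3.
      pose proof (pos_INR (n + i)).
      apply Rle_trans with (x * x / ((INR (n + i) + 1) * (INR (n + i) + 1)) * (2 / (INR (n + i) + 1))).
      - apply Rmult_le_compat; lra.
      - replace (x * x / ((INR (n + i) + 1) * (INR (n + i) + 1)) * (2 / (INR (n + i) + 1))) with
          (2 * (x * x) * (1 / ((INR (n + i) + 1) * ((INR (n + i) + 1) * (INR (n + i) + 1))))) by (field; lra).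
        rewrite (Rmult_assoc (2 * (x * x)) (1 / INR n)). apply Rmult_le_compat_l; [nra | exact B3]. }
    assert (Q : psum (fun m => weight x m * kernel (S m) 1) n <= psum (fun m => kernel (S m) 1) n).
    { apply psum_le. intros m _. pose proof (weight_le1 x m Hx).
      destruct (kernel_bounds (S m) 1) as (K & _). simpl Z.of_nat in K. nra. }
    assert (E : 2 * (x * x) * (1 / INR n) * (1 / INR n) <= 5).
    { replace (2 * (x * x) * (1 / INR n) * (1 / INR n)) with (2 * ((x / INR n) * (x / INR n))) by (field; lra).
      assert (0 <= x / INR n <= 3 / 2).
      { split; [apply Rdiv_le_0_compat; lra | apply Rle_div_l; lra]. }
      nra. }
    lra.
Qed.

(** * Deviation of the kernel from linearity in [j] *)

Lemma kernel_succ m j :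
  kernel (S m) (Z.of_nat (S j)) - kernel (S m) (Z.of_nat j) =
  1 / (2 * INR m + 2 * INR j + 3) + 1 / (2 * INR m - 2 * INR j + 1).
Proof.
  assert (H1 : odd_harmonic (Z.abs_nat (Z.of_nat (S m) + Z.of_nat (S j))) -
     odd_harmonic (Z.abs_nat (Z.of_nat (S m) + Z.of_nat j)) = 1 / (2 * INR m + 2 * INR j + 3)).
  { replace (Z.abs_nat (Z.of_nat (S m) + Z.of_nat (S j))) with (S (S m + j)) by lia.
    replace (Z.abs_nat (Z.of_nat (S m) + Z.of_nat j)) with (S m + j)%nat by lia.
    rewrite odd_harmonic_S, plus_INR, S_INR. pose proof (pos_INR m). pose proof (pos_INR j). field. lra. }
  assert (H2 : odd_harmonic (Z.abs_nat (Z.of_nat (S m) - Z.of_nat j)) -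
     odd_harmonic (Z.abs_nat (Z.of_nat (S m) - Z.of_nat (S j))) = 1 / (2 * INR m - 2 * INR j + 1)).
  (* When [j > m], the absolute value reverses the order of the two arguments, and the fraction is
     negative accordingly; one formula covers both cases. *)
  { destruct (Nat.le_gt_cases j m) as [H|H].
    - replace (Z.abs_nat (Z.of_nat (S m) - Z.of_nat j)) with (S (m - j)) by lia.
      replace (Z.abs_nat (Z.of_nat (S m) - Z.of_nat (S j))) with (m - j)%nat by lia.
      rewrite odd_harmonic_S, minus_INR by lia. apply le_INR in H. field. lra.
    - replace (Z.abs_nat (Z.of_nat (S m) - Z.of_nat (S j))) with (S (j - S m)) by lia.
      replace (Z.abs_nat (Z.of_nat (S m) - Z.of_nat j)) with (j - S m)%nat by lia.
      rewrite odd_harmonic_S, minus_INR by lia. apply (le_INR (S m)) in H. rewrite S_INR in *. field. lra. }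
  unfold kernel. lra.
Qed.

Definition kernel_defect (m j : nat) : R := INR j * kernel (S m) 1 - kernel (S m) (Z.of_nat j).

Lemma kernel_0 m : kernel m 0 = 0.
Proof. unfold kernel. rewrite Z.add_0_r, Z.sub_0_r. ring. Qed.

(** Away from the diagonal the kernel is convex in [j]: by [kernel_succ], each increment exceeds the
    first one by at most [2 j^2 / (m + 1)^3], and there are [j] increments. *)
Lemma kernel_defect_far m j : (2 * j <= m)%nat ->
  0 <= - kernel_defect m j <= INR j * (2 * (INR j * INR j) *
     (1 / ((INR m + 1) * ((INR m + 1) * (INR m + 1))))).
Proof.
  intros Hm. set (B := 2 * (INR j * INR j) * (1 / ((INR m + 1) * ((INR m + 1) * (INR m + 1))))).
  enough (H : forall i, (i <= j)%nat -> 0 <= - kernel_defect m i <= INR i * B) by (apply H; lia).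
  induction i as [|i IH]; intros Hi.
  - unfold kernel_defect. simpl INR. simpl Z.of_nat. rewrite kernel_0. lra.
  - specialize (IH ltac:(lia)). pose proof (kernel_succ m i) as K. unfold kernel_defect in *.
    rewrite S_INR. enough (0 <= kernel (S m) (Z.of_nat (S i)) - kernel (S m) (Z.of_nat i) - kernel (S m) 1 <= B) by lra.
    rewrite K, kernel_one. unfold B.
    apply (le_INR (S i)) in Hi. rewrite S_INR in Hi. apply le_INR in Hm. rewrite mult_INR in Hm.
    change (INR 2) with 2 in Hm.
    pose proof (pos_INR i) as Hi0. clear - Hi Hm Hi0.
    set (y := INR m) in *. set (b := INR i) in *. set (c := INR j) in *.
    replace (1 / (2 * y + 2 * b + 3) + 1 / (2 * y - 2 * b + 1) - (1 / (2 * y + 1) + 1 / (2 * y + 3)))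
      with (16 * (y + 1) * (b * (b + 1)) * / (((2 * y + 2 * b + 3) * (2 * y - 2 * b + 1)) * ((2 * y + 1) * (2 * y + 3))))
      by (field; lra).
    split.
    + apply Rmult_le_pos; [nra|]. apply Rlt_le, Rinv_0_lt_compat.
      repeat apply Rmult_lt_0_compat; lra.
    + set (M := y + 1).
      assert (P1 : 3 * (M * M) <= (2 * y + 2 * b + 3) * (2 * y - 2 * b + 1)) by (unfold M; nra).
      assert (P2 : 3 * (M * M) <= (2 * y + 1) * (2 * y + 3)) by (unfold M; nra).
      assert (P0 : 0 < M * M) by (unfold M; nra).
      assert (P3 : 9 * ((M * M) * (M * M)) <=
        ((2 * y + 2 * b + 3) * (2 * y - 2 * b + 1)) * ((2 * y + 1) * (2 * y + 3))).
      { replace (9 * ((M * M) * (M * M))) with ((3 * (M * M)) * (3 * (M * M))) by ring.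
        apply Rmult_le_compat; lra. }
      assert (P4 : b * (b + 1) <= c * c) by nra.
      apply Rle_trans with (16 * M * (c * c) * / (9 * ((M * M) * (M * M)))).
      * apply Rmult_le_compat.
        -- unfold M. nra.
        -- apply Rlt_le, Rinv_0_lt_compat. nra.
        -- apply Rmult_le_compat_l; [unfold M; lra | exact P4].
        -- apply Rinv_le_contravar; [nra | exact P3].
      * replace (16 * M * (c * c) * / (9 * (M * M * (M * M)))) with
          ((c * c) * (16 / 9 * (1 / (M * (M * M))))) by (field; unfold M; lra).
        replace (2 * (c * c) * (1 / (M * (M * M)))) with ((c * c) * (2 * (1 / (M * (M * M))))) by ring.
        apply Rmult_le_compat_l; [nra|]. apply Rmult_le_compat_r; [|lra].
        apply Rdiv_le_0_compat; [lra|]. unfold M. repeat apply Rmult_lt_0_compat; lra.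
Qed.

Lemma odd_harmonic_diff_le a d : odd_harmonic (a + d) - odd_harmonic a <= INR d / (2 * INR a + 1).
Proof.
  pose proof (pos_INR a) as Ha. induction d as [|d IH].
  - rewrite Nat.add_0_r. simpl INR. unfold Rdiv. lra.
  - rewrite Nat.add_succ_r, odd_harmonic_S, S_INR, plus_INR. pose proof (pos_INR d).
    assert (1 / (2 * (INR a + INR d) + 1) <= 1 / (2 * INR a + 1)).
    { apply Rmult_le_compat_l; [lra|]. apply Rinv_le_contravar; lra. }
    replace ((INR d + 1) / (2 * INR a + 1)) with (INR d / (2 * INR a + 1) + 1 / (2 * INR a + 1)) by (field; lra).
    lra.
Qed.

(** The sum with [odd_harmonic j] in place of [odd_harmonic (3 * j)] is at most [j], by induction,
    and [odd_harmonic (3 * j)] exceeds [odd_harmonic j] by at most 1. *)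
Lemma psum_odd_harmonic_diff j : psum (fun i => odd_harmonic (3 * j) - odd_harmonic i) j <= 2 * INR j.
Proof.
  assert (H1 : forall k, psum (fun i => odd_harmonic k - odd_harmonic i) k <= INR k).
  { induction k as [|k IH]; [simpl; lra|].
    assert (E : psum (fun i => odd_harmonic (S k) - odd_harmonic i) k =
      psum (fun i => odd_harmonic k - odd_harmonic i) k + INR k * (1 / (2 * INR k + 1))).
    { rewrite odd_harmonic_S. generalize (1 / (2 * INR k + 1)) as e. generalize (odd_harmonic k) as h.
      clear. intros h e. induction k as [|k IH]; [simpl; ring|].
      rewrite S_INR. cbn [psum]. rewrite IH. ring. }
    cbn [psum]. rewrite E, odd_harmonic_S, S_INR. pose proof (pos_INR k).
    assert (INR k * (1 / (2 * INR k + 1)) + 1 / (2 * INR k + 1) <= 1).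
    { replace (INR k * (1 / (2 * INR k + 1)) + 1 / (2 * INR k + 1)) with ((INR k + 1) / (2 * INR k + 1)) by (field; lra).
      destruct k as [|k]; [simpl; lra|]. apply Rle_div_l; lra. }
    lra. }
  specialize (H1 j).
  assert (H2 : odd_harmonic (3 * j) - odd_harmonic j <= 1).
  { pose proof (odd_harmonic_diff_le j (2 * j)) as K. replace (j + 2 * j)%nat with (3 * j)%nat in K by lia.
    pose proof (pos_INR j). rewrite mult_INR in K. change (INR 2) with 2 in K.
    assert (2 * INR j / (2 * INR j + 1) <= 1) by (apply Rle_div_l; lra). lra. }
  rewrite psum_minus in *.
  assert (E : forall c k, psum (fun _ => c) k = INR k * c).
  { intros c k. clear. induction k as [|k IH]; [simpl; ring|]. rewrite S_INR. cbn [psum]. rewrite IH. ring. }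
  rewrite E in *. pose proof (pos_INR j). nra.
Qed.

(** The kernel has a logarithmic peak near the diagonal, yet its sum there is only linear in [j].
    Each half of the range is compared with [psum_odd_harmonic_diff], indexed by the distance to the
    diagonal. *)
Lemma psum_kernel_near j : psum (fun m => kernel (S m) (Z.of_nat j)) (2 * j) <= 4 * INR j.
Proof.
  assert (Hm : forall a b, (a <= b)%nat -> odd_harmonic a <= odd_harmonic b).
  { intros a b H. replace b with (a + (b - a))%nat by lia. pose proof (odd_harmonic_diff a (b - a)). lra. }
  pose proof (psum_odd_harmonic_diff j) as H.
  replace (2 * j)%nat with (j + j)%nat by lia. rewrite psum_split.
  assert (psum (fun m => kernel (S m) (Z.of_nat j)) j <= psum (fun i => odd_harmonic (3 * j) - odd_harmonic i) j).
  { rewrite (psum_rev (fun i => odd_harmonic (3 * j) - odd_harmonic i)). apply psum_le. intros i Hi. unfold kernel.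
    replace (Z.abs_nat (Z.of_nat (S i) - Z.of_nat j)) with (j - 1 - i)%nat by lia.
    pose proof (Hm (Z.abs_nat (Z.of_nat (S i) + Z.of_nat j)) (3 * j)%nat ltac:(lia)). lra. }
  assert (psum (fun i => kernel (S (j + i)) (Z.of_nat j)) j <= psum (fun i => odd_harmonic (3 * j) - odd_harmonic i) j).
  { apply psum_le. intros i Hi. unfold kernel.
    replace (Z.abs_nat (Z.of_nat (S (j + i)) - Z.of_nat j)) with (S i) by lia.
    pose proof (Hm i (S i) ltac:(lia)).
    pose proof (Hm (Z.abs_nat (Z.of_nat (S (j + i)) + Z.of_nat j)) (3 * j)%nat ltac:(lia)). lra. }
  lra.
Qed.

(** A majorant of the negative part of [kernel_defect], independent of [x] and with total mass at
    most [5 j]. *)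
Definition defect_bound (m j : nat) : R :=
  if (m <? 2 * j)%nat then kernel (S m) (Z.of_nat j)
  else INR j * (2 * (INR j * INR j) * (1 / ((INR m + 1) * ((INR m + 1) * (INR m + 1))))).

Lemma defect_bound_nonneg m j : 0 <= defect_bound m j.
Proof.
  unfold defect_bound. destruct (Nat.ltb_spec m (2 * j)); [apply kernel_bounds|].
  pose proof (pos_INR m). pose proof (pos_INR j).
  assert (0 < 1 / ((INR m + 1) * ((INR m + 1) * (INR m + 1)))).
  { apply Rdiv_lt_0_compat; [lra|]. repeat apply Rmult_lt_0_compat; lra. }
  apply Rmult_le_pos; [assumption|]. apply Rmult_le_pos; nra.
Qed.

Lemma defect_bound_series j : (1 <= j)%nat ->
  exists s : R, is_series (fun m => defect_bound m j) s /\ s <= 5 * INR j.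
Proof.
  intros Hj. assert (Hj' : 1 <= INR j) by (apply (le_INR 1); exact Hj).
  set (c := INR j * (2 * (INR j * INR j)) * (1 / INR (2 * j))).
  pose proof (is_series_mult_l c _ _ (inv_consecutive_series (2 * j) ltac:(lia))) as HT.
  assert (B : forall i, Rabs (defect_bound (2 * j + i) j) <=
    c * (1 / (INR (2 * j + i) * (INR (2 * j + i) + 1)))).
  { intros i. rewrite Rabs_pos_eq by apply defect_bound_nonneg. unfold defect_bound.
    destruct (Nat.ltb_spec (2 * j + i) (2 * j)); [lia|].
    pose proof (inv_cube_le (2 * j) i ltac:(lia)) as K. unfold c.
    rewrite !Rmult_assoc. rewrite <- (Rmult_assoc 2).
    apply Rmult_le_compat_l; [lra|]. rewrite <- !Rmult_assoc in *.
    rewrite !Rmult_assoc in *.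
    apply Rmult_le_compat_l; [lra|]. apply Rmult_le_compat_l; [lra|].
    apply Rmult_le_compat_l; [lra|]. exact K. }
  destruct (series_dominated _ _ _ B HT) as (t & Ht & Hle).
  exists (t + psum (fun m => defect_bound m j) (2 * j)). split.
  - apply (is_series_drop _ _ (2 * j)).
    apply is_series_eq with (3 := Ht); [reflexivity | ring].
  - assert (E : psum (fun m => defect_bound m j) (2 * j) <= 4 * INR j).
    { rewrite (psum_ext _ (fun m => kernel (S m) (Z.of_nat j))); [apply psum_kernel_near|].
      intros i Hi. unfold defect_bound. destruct (Nat.ltb_spec i (2 * j)); [reflexivity | lia]. }
    assert (c * (1 / INR (2 * j)) <= INR j).
    { unfold c. rewrite mult_INR. change (INR 2) with 2.
      replace (INR j * (2 * (INR j * INR j)) * (1 / (2 * INR j)) * (1 / (2 * INR j)))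
        with (INR j / 2) by (field; lra). lra. }
    apply Rabs_le_between in Hle. lra.
Qed.

Definition phi_defect (x : R) (j : nat) : R := INR j * phi x 1 - phi x j.

Lemma phi_defect_series x j : 2 <= x -> is_series (fun m => weight x m * kernel_defect m j) (phi_defect x j).
Proof.
  intros Hx. apply is_series_eq with (3 := is_series_sub _ _ _ _
    (is_series_mult_l (INR j) _ _ (phi_series x 1 Hx)) (phi_series x j Hx)); [|reflexivity].
  intros m. unfold kernel_defect. simpl (Z.of_nat 1). ring.
Qed.

Lemma kernel_one_nonneg m : 0 <= kernel (S m) 1.
Proof. exact (proj1 (kernel_bounds (S m) 1)). Qed.

Lemma kernel_defect_bounds m j : - defect_bound m j <= kernel_defect m j <= INR j * kernel (S m) 1.
Proof.
  pose proof (kernel_one_nonneg m). pose proof (pos_INR j).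
  destruct (kernel_bounds (S m) j) as (K & _).
  assert (0 <= INR j * kernel (S m) 1) by now apply Rmult_le_pos.
  unfold defect_bound. destruct (Nat.ltb_spec m (2 * j)) as [Hm|Hm].
  - unfold kernel_defect. lra.
  - pose proof (kernel_defect_far m j Hm). lra.
Qed.

(** Only the positive part [j * kernel (S m) 1] with [m < n] is kept; everything negative is charged
    to [defect_bound]. *)
Lemma phi_defect_lower x j n : 2 <= x -> (1 <= j)%nat -> (n <= 2 * j)%nat ->
  INR j * (psum (fun m => weight x m * kernel (S m) 1) n - 5) <= phi_defect x j.
Proof.
  intros Hx Hj Hn. destruct (defect_bound_series j Hj) as (s & Hs & Hle).
  set (f := fun m => if (m <? n)%nat then INR j * (weight x m * kernel (S m) 1) else 0).
  assert (Hf : is_series f (INR j * psum (fun m => weight x m * kernel (S m) 1) n)).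
  { rewrite <- psum_scal. rewrite (psum_ext _ f).
    - apply is_series_finite. intros i Hi. unfold f. destruct (Nat.ltb_spec i n); [lia | reflexivity].
    - intros i Hi. unfold f. destruct (Nat.ltb_spec i n); [reflexivity | lia]. }
  enough (INR j * psum (fun m => weight x m * kernel (S m) 1) n - s <= phi_defect x j) by lra.
  apply series_le with (2 := is_series_sub _ _ _ _ Hf Hs) (3 := phi_defect_series x j Hx).
  intros m. unfold f. pose proof (weight_pos x m Hx). pose proof (weight_le1 x m Hx).
  pose proof (kernel_defect_bounds m j) as [B _]. pose proof (defect_bound_nonneg m j).
  destruct (Nat.ltb_spec m n) as [Hm|Hm].
  - unfold kernel_defect, defect_bound in *. destruct (Nat.ltb_spec m (2 * j)); [|lia].
    destruct (kernel_bounds (S m) j) as (K & _). nra.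
  - nra.
Qed.

(** The weights increase with [x], so their differences lie in [[0, 1]]. Since [kernel_defect] is at
    most [j * kernel (S m) 1] plus [defect_bound] in absolute value, the first part sums to
    [j * (phi y 1 - phi x 1)] and the second to at most [5 j]. *)
Lemma phi_defect_diff_le x y j : 2 <= x -> x <= y -> (1 <= j)%nat ->
  Rabs (phi_defect y j - phi_defect x j) <= INR j * (Rabs (phi y 1 - phi x 1) + 5).
Proof.
  intros Hx Hy Hj. destruct (defect_bound_series j Hj) as (s & Hs & Hle).
  assert (Hy2 : 2 <= y) by lra.
  pose proof (is_series_mult_l (INR j) _ _
    (is_series_sub _ _ _ _ (phi_series y 1 Hy2) (phi_series x 1 Hx))) as K.
  apply Rle_trans with (INR j * (phi y 1 - phi x 1) + s).
  - apply series_abs_le with (2 := is_series_sub _ _ _ _ (phi_defect_series y j Hy2) (phi_defect_series x j Hx))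
      (3 := is_series_add _ _ _ _ K Hs).
    intros m. simpl Z.of_nat. pose proof (weight_mono x y m Hx Hy). pose proof (weight_le1 y m Hy2).
    pose proof (weight_pos x m Hx). pose proof (kernel_defect_bounds m j) as [B1 B2]. pose proof (defect_bound_nonneg m j).
    pose proof (kernel_one_nonneg m). pose proof (pos_INR j).
    assert (0 <= INR j * kernel (S m) 1) by now apply Rmult_le_pos.
    replace (weight y m * kernel_defect m j - weight x m * kernel_defect m j) with ((weight y m - weight x m) * kernel_defect m j) by ring.
    replace (INR j * (weight y m * kernel (S m) 1 - weight x m * kernel (S m) 1)) with
      ((weight y m - weight x m) * (INR j * kernel (S m) 1)) by ring.
    apply Rabs_le. split; nra.
  - pose proof (Rle_abs (phi y 1 - phi x 1)). pose proof (pos_INR j). nra.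
Qed.

Lemma phi_defect_diff_le_sym x y j : 2 <= x -> 2 <= y -> (1 <= j)%nat ->
  Rabs (phi_defect y j - phi_defect x j) <= INR j * (Rabs (phi y 1 - phi x 1) + 5).
Proof.
  intros Hx Hy Hj. destruct (Rle_or_lt x y) as [H|H].
  - now apply phi_defect_diff_le.
  - rewrite (Rabs_minus_sym (phi_defect y j)), (Rabs_minus_sym (phi y 1)). apply phi_defect_diff_le; auto. lra.
Qed.

Lemma phi_one_scale x lam : 0 < lam -> 2 <= x -> 2 <= lam * x ->
  Rabs (phi (lam * x) 1 - phi x 1) <= Rabs (ln lam) + 14.
Proof.
  intros Hl Hx Hy. pose proof (phi_one_ln x Hx) as H1. pose proof (phi_one_ln _ Hy) as H2.
  rewrite ln_mult in H2 by lra.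
  apply Rabs_le_between in H1, H2. pose proof (Rle_abs (ln lam)). pose proof (Rle_abs (- ln lam)).
  rewrite Rabs_Ropp in H0. apply Rabs_le. lra.
Qed.

(** The cubic decay leaves room for a factor [m + 1], the one appearing in [weight_near1]; this
    yields the rate [1 / x] in [phi_defect_rate]. *)
Lemma kernel_defect_weighted_series j : (1 <= j)%nat ->
  ex_series (fun m => (INR m + 1) * Rabs (kernel_defect m j)).
Proof.
  intros Hj. apply (ex_series_incr_n _ (2 * j)).
  assert (Hj' : 1 <= INR j) by (apply (le_INR 1); exact Hj).
  set (c := INR j * (2 * (INR j * INR j))).
  assert (B : forall i, Rabs ((INR (2 * j + i) + 1) * Rabs (kernel_defect (2 * j + i) j)) <=
    c * (1 / (INR (2 * j + i) * (INR (2 * j + i) + 1)))).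
  { intros i. pose proof (kernel_defect_far (2 * j + i) j ltac:(lia)) as [K0 K].
    pose proof (pos_INR (2 * j + i)) as Hp.
    assert (Hp1 : 1 <= INR (2 * j + i)) by (apply (le_INR 1); lia).
    rewrite Rabs_mult, Rabs_Rabsolu, (Rabs_pos_eq (_ + 1)) by lra.
    rewrite <- (Rabs_Ropp (kernel_defect _ _)), (Rabs_pos_eq (- _)) by exact K0.
    set (y := INR (2 * j + i)) in *.
    apply Rle_trans with ((y + 1) * (INR j * (2 * (INR j * INR j) * (1 / ((y + 1) * ((y + 1) * (y + 1))))))).
    - apply Rmult_le_compat_l; lra.
    - replace ((y + 1) * (INR j * (2 * (INR j * INR j) * (1 / ((y + 1) * ((y + 1) * (y + 1))))))) with
        (c * (1 / ((y + 1) * (y + 1)))) by (unfold c; field; lra).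
      apply Rmult_le_compat_l; [unfold c; nra|].
      apply Rmult_le_compat_l; [lra|]. apply Rinv_le_contravar; nra. }
  destruct (series_dominated _ _ _ B
    (is_series_mult_l c _ _ (inv_consecutive_series (2 * j) ltac:(lia)))) as [a [Ha _]].
  now exists a.
Qed.

Lemma kernel_defect_series j : (1 <= j)%nat -> ex_series (fun m => kernel_defect m j).
Proof.
  intros Hj. apply (ex_series_le (fun m => kernel_defect m j) (fun m => (INR m + 1) * Rabs (kernel_defect m j)));
    [|now apply kernel_defect_weighted_series].
  intros m. change (Rabs (kernel_defect m j) <= (INR m + 1) * Rabs (kernel_defect m j)).
  pose proof (pos_INR m). pose proof (Rabs_pos (kernel_defect m j)). nra.
Qed.

Definition phi_defect_lim (j : nat) : R := Series (fun m => kernel_defect m j).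

Lemma phi_defect_rate j : (1 <= j)%nat ->
  exists c : R, 0 <= c /\ forall x, 2 <= x -> Rabs (phi_defect x j - phi_defect_lim j) <= c / x.
Proof.
  intros Hj. pose proof (ex_series_is _ (kernel_defect_weighted_series j Hj)) as Hw.
  set (w := Series (fun m => (INR m + 1) * Rabs (kernel_defect m j))) in *.
  exists (3 * w). split.
  - assert (0 <= w); [|lra]. apply series_nonneg with (2 := Hw).
    intros m. pose proof (pos_INR m). pose proof (Rabs_pos (kernel_defect m j)). nra.
  - intros x Hx. replace (3 * w / x) with (3 / x * w) by (field; lra).
    apply series_abs_le with
      (2 := is_series_sub _ _ _ _ (phi_defect_series x j Hx) (ex_series_is _ (kernel_defect_series j Hj)))
      (3 := is_series_mult_l (3 / x) _ _ Hw).
    intros m. pose proof (weight_near1 x m Hx). pose proof (weight_le1 x m Hx).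
    replace (weight x m * kernel_defect m j - kernel_defect m j) with (- ((1 - weight x m) * kernel_defect m j)) by ring.
    rewrite Rabs_Ropp, Rabs_mult, (Rabs_pos_eq (1 - _)) by lra.
    replace (3 / x * ((INR m + 1) * Rabs (kernel_defect m j))) with
      (3 * (INR m + 1) / x * Rabs (kernel_defect m j)) by (field; lra).
    apply Rmult_le_compat_r; [apply Rabs_pos | lra].
Qed.

Lemma is_lim_seq_inv_affine (c : R) : is_lim_seq (fun N => 1 / (2 * INR N + c)) 0.
Proof.
  apply is_lim_seq_ext with (fun N => / (2 * INR N + c)).
  { intros n. unfold Rdiv. ring. }
  apply (is_lim_seq_inv (fun N => 2 * INR N + c) p_infty); [|discriminate].
  apply is_lim_seq_plus with p_infty c; [|apply is_lim_seq_const | reflexivity].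
  apply is_lim_seq_ext with (fun n => INR n + INR n); [intros; ring|].
  apply is_lim_seq_plus with p_infty p_infty; [apply is_lim_seq_INR | apply is_lim_seq_INR | reflexivity].
Qed.

Lemma kernel_defect_0 m : kernel_defect m 0 = 0.
Proof. unfold kernel_defect. simpl. rewrite kernel_0. ring. Qed.

Lemma kernel_defect_1 m : kernel_defect m 1 = 0.
Proof. unfold kernel_defect. simpl. ring. Qed.

(* The second difference of [kernel_defect] in [j] telescopes in [m]. *)
Lemma phi_defect_lim_second_difference j :
  phi_defect_lim (S (S j)) - 2 * phi_defect_lim (S j) + phi_defect_lim j =
  1 / (2 * INR j + 1) + 1 / (2 * INR j + 3).
Proof.
  assert (H0 : is_series (fun m => kernel_defect m j) (phi_defect_lim j)).
  { destruct j as [|j]; [|apply ex_series_is, kernel_defect_series; lia].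
    apply ex_series_is. exists 0. apply is_series_ext with (fun _ => 0).
    - intros m. symmetry. apply kernel_defect_0.
    - apply (is_series_finite (fun _ => 0) 0). reflexivity. }
  pose proof (ex_series_is _ (kernel_defect_series (S j) ltac:(lia))) as H1.
  pose proof (ex_series_is _ (kernel_defect_series (S (S j)) ltac:(lia))) as H2.
  apply is_series_uniq with (1 := is_series_add _ _ _ _
    (is_series_sub _ _ _ _ H2 (is_series_mult_l 2 _ _ H1)) H0).
  apply is_series_psum.
  apply is_lim_seq_ext with (fun N =>
    (1 / (2 * INR N + (- 2 * INR j - 1)) - 1 / (2 * INR N + (2 * INR j + 3)))
    - (1 / (- 2 * INR j - 1) - 1 / (2 * INR j + 3))).
  - intros N.
    assert (NZ : forall m a, 2 * INR m + (- 2 * INR a - 1) <> 0).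
    { intros m a E. assert (E' : IZR (2 * Z.of_nat m - 2 * Z.of_nat a - 1) = 0).
      { rewrite !minus_IZR, !mult_IZR, <- !INR_IZR_INZ. lra. }
      apply eq_IZR in E'. lia. }
    set (F := fun N => 1 / (2 * INR N + (- 2 * INR j - 1)) - 1 / (2 * INR N + (2 * INR j + 3))).
    rewrite (psum_ext _ (fun m => F (S m) - F m)).
    + rewrite psum_telescope. unfold F. simpl (INR 0).
      pose proof (pos_INR j). replace (2 * 0 + (- 2 * INR j - 1)) with (- 2 * INR j - 1) by ring.
      replace (2 * 0 + (2 * INR j + 3)) with (2 * INR j + 3) by ring. reflexivity.
    + intros m _. unfold F. pose proof (kernel_succ m j) as K0. pose proof (kernel_succ m (S j)) as K1.
      unfold kernel_defect. rewrite !S_INR in *.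
      pose proof (NZ m j) as N0. pose proof (NZ (S m) j) as N1. rewrite S_INR in N1.
      replace (2 * INR m + 2 * (INR j + 1) + 3) with (2 * (INR m + 1) + (2 * INR j + 3)) in K1 by ring.
      replace (2 * INR m - 2 * (INR j + 1) + 1) with (2 * INR m + (- 2 * INR j - 1)) in K1 by ring.
      replace (2 * INR m + 2 * INR j + 3) with (2 * INR m + (2 * INR j + 3)) in K0 by ring.
      replace (2 * INR m - 2 * INR j + 1) with (2 * (INR m + 1) + (- 2 * INR j - 1)) in K0 by ring.
      lra.
  - replace (1 / (2 * INR j + 1) + 1 / (2 * INR j + 3)) with
      (0 - 0 - (1 / (- 2 * INR j - 1) - 1 / (2 * INR j + 3)))
      by (pose proof (pos_INR j); field; lra).
    apply is_lim_seq_minus'; [|apply is_lim_seq_const].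
    apply is_lim_seq_minus'; apply is_lim_seq_inv_affine.
Qed.

(** A sequence that vanishes at 0 and 1 and has positive second differences is positive from 2
    on. *)
Lemma phi_defect_lim_pos j : (2 <= j)%nat -> 0 < phi_defect_lim j.
Proof.
  assert (Z : forall i, (i <= 1)%nat -> phi_defect_lim i = 0).
  { intros i Hi. apply is_series_unique. apply is_series_ext with (fun _ => 0).
    - intros m. destruct i as [|[|i]]; [now rewrite kernel_defect_0 | now rewrite kernel_defect_1 | lia].
    - apply (is_series_finite (fun _ => 0) 0). reflexivity. }
  assert (P : forall i, 0 <= phi_defect_lim (S i) /\ 0 < phi_defect_lim (S (S i)) - phi_defect_lim (S i)).
  { induction i as [|i [IH1 IH2]].
    - pose proof (phi_defect_lim_second_difference 0) as K. rewrite (Z 0%nat), (Z 1%nat) in * by lia.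
      simpl INR in K. lra.
    - pose proof (phi_defect_lim_second_difference (S i)) as K. pose proof (pos_INR (S i)).
      assert (0 < 1 / (2 * INR (S i) + 1)) by (apply Rdiv_lt_0_compat; lra).
      assert (0 < 1 / (2 * INR (S i) + 3)) by (apply Rdiv_lt_0_compat; lra). lra. }
  intros Hj. destruct j as [|[|j]]; [lia | lia|]. pose proof (P j). lra.
Qed.

Lemma phi_defect_large M :
  exists (J : nat) (X : R), (1 <= J)%nat /\ 2 <= X /\
    forall j x, (J <= j)%nat -> X <= x -> INR j * M <= phi_defect x j.
Proof.
  destruct (nfloor_ex (exp (2 * (M + 5)))) as [n [_ Hn]]; [apply Rlt_le, exp_pos|].
  (* For [x >= 6 (n + 1)] the weights with [m <= n] are at least 1/2, and [n] is so large that half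
     the logarithm exceeds [M + 5], the 5 being the loss in [phi_defect_lower]. *)
  exists (S n), (Rmax 2 (6 * INR (S n))).
  split; [lia|]. split; [apply Rmax_l|]. intros j x Hj Hx.
  assert (Hx2 : 2 <= x) by (eapply Rle_trans; [apply Rmax_l | exact Hx]).
  assert (Hx6 : 6 * INR (S n) <= x) by (eapply Rle_trans; [apply Rmax_r | exact Hx]).
  apply Rle_trans with (2 := phi_defect_lower x j (S n) Hx2 ltac:(lia) ltac:(lia)).
  apply Rmult_le_compat_l; [apply pos_INR|].
  assert (K : psum (fun m => 1 / 2 * kernel (S m) 1) (S n) <= psum (fun m => weight x m * kernel (S m) 1) (S n)).
  { apply psum_le. intros m Hm. apply Rmult_le_compat_r; [apply kernel_one_nonneg|].
    pose proof (weight_near1 x m Hx2). apply (le_INR (S m)) in Hm. rewrite (S_INR m) in Hm.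
    assert (3 * (INR m + 1) / x <= 1 / 2) by (apply Rle_div_l; lra). lra. }
  rewrite psum_scal in K. pose proof (psum_kernel_one_bounds n) as [L _].
  assert (2 * (M + 5) <= ln (INR (S n) + 1)).
  { rewrite <- (ln_exp (2 * (M + 5))). apply ln_le; [apply exp_pos|]. rewrite S_INR. lra. }
  lra.
Qed.

(** * Slow variation of the defect, uniformly in [j] *)

Lemma finite_eventually (P : nat -> R -> Prop) (J : nat) :
  (forall j, (j < J)%nat -> exists X, forall x, X <= x -> P j x) ->
  exists X, forall x, X <= x -> forall j, (j < J)%nat -> P j x.
Proof.
  induction J as [|J IH]; intros H.
  - exists 0. intros x _ j Hj. lia.
  - destruct IH as [X1 H1]; [intros; apply H; lia|].
    destruct (H J ltac:(lia)) as [X2 H2]. exists (Rmax X1 X2). intros x Hx j Hj.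
    pose proof (Rmax_l X1 X2). pose proof (Rmax_r X1 X2).
    destruct (Nat.eq_dec j J) as [->|E]; [apply H2; lra | apply H1; [lra | lia]].
Qed.

Lemma phi_defect_near_lim j eta : (1 <= j)%nat -> 0 < eta ->
  exists X, 2 <= X /\ forall x, X <= x -> Rabs (phi_defect x j - phi_defect_lim j) <= eta.
Proof.
  intros Hj He. destruct (phi_defect_rate j Hj) as (c & Hc & H).
  exists (Rmax 2 (c / eta)). split; [apply Rmax_l|]. intros x Hx.
  pose proof (Rmax_l 2 (c / eta)). pose proof (Rmax_r 2 (c / eta)).
  apply Rle_trans with (1 := H x ltac:(lra)).
  apply Rle_div_l; [lra|]. assert (K : c / eta <= x) by lra. apply Rle_div_l in K; lra.
Qed.

(** For large [j] the change is at most [C j], small relative to [phi_defect] by [phi_defect_large].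
    The finitely many [j >= 2] left have a positive limit, and at [j = 1] the defect is identically
    zero. The threshold is thus common to all [j]. *)
Lemma phi_defect_slowly_varying lam eps : 0 < lam -> 0 < eps ->
  exists X, 2 <= X /\ forall x, X <= x -> 2 <= lam * x /\
    forall j, (1 <= j)%nat -> Rabs (phi_defect (lam * x) j - phi_defect x j) <= eps * phi_defect x j.
Proof.
  intros Hl He. set (C := Rabs (ln lam) + 14 + 5).
  destruct (phi_defect_large (C / eps)) as (J & X1 & HJ & HX1 & H1).
  destruct (finite_eventually (fun j x => (2 <= j)%nat ->
     Rabs (phi_defect (lam * x) j - phi_defect x j) <= eps * phi_defect x j) J) as [X2 H2].
  { intros j _. destruct (Nat.le_gt_cases 2 j) as [Hj|Hj]; [|exists 0; intros; lia].
    (* This [eta] solves [2 eta = eps (phi_defect_lim j - eta)]: twice the distance to the limit is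
       at most [eps] times the least possible value. *)
    pose proof (phi_defect_lim_pos j Hj) as Hu. set (eta := eps * phi_defect_lim j / (2 + eps)).
    assert (Heta : 0 < eta) by (apply Rdiv_lt_0_compat; [now apply Rmult_lt_0_compat | lra]).
    destruct (phi_defect_near_lim j eta ltac:(lia) Heta) as (X & HX & H).
    exists (Rmax X (X / lam)). intros x Hx _.
    pose proof (Rmax_l X (X / lam)). pose proof (Rmax_r X (X / lam)).
    assert (X <= lam * x).
    { assert (K : X / lam <= x) by lra. apply Rle_div_l in K; lra. }
    pose proof (H x ltac:(lra)) as A1. pose proof (H (lam * x) ltac:(lra)) as A2.
    apply Rabs_le_between in A1, A2. assert (E : 2 * eta = eps * (phi_defect_lim j - eta)) by (unfold eta; field; lra).
    assert (eps * (phi_defect_lim j - eta) <= eps * phi_defect x j) by (apply Rmult_le_compat_l; lra).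
    apply Rabs_le. lra. }
  exists (Rmax (Rmax X1 X2) (2 / lam)).
  pose proof (Rmax_l (Rmax X1 X2) (2 / lam)). pose proof (Rmax_r (Rmax X1 X2) (2 / lam)).
  pose proof (Rmax_l X1 X2). pose proof (Rmax_r X1 X2).
  split; [lra|]. intros x Hx.
  assert (Hlx : 2 <= lam * x).
  { assert (K : 2 / lam <= x) by lra. apply Rle_div_l in K; lra. }
  split; [exact Hlx|]. intros j Hj.
  destruct (Nat.le_gt_cases J j) as [HJj|HJj].
  - apply Rle_trans with (1 := phi_defect_diff_le_sym x (lam * x) j ltac:(lra) Hlx Hj).
    pose proof (phi_one_scale x lam Hl ltac:(lra) Hlx).
    pose proof (H1 j x HJj ltac:(lra)) as K. pose proof (pos_INR j).
    apply Rle_trans with (INR j * C); [apply Rmult_le_compat_l; unfold C; lra|].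
    apply Rle_trans with (eps * (INR j * (C / eps))).
    + right. field. lra.
    + apply Rmult_le_compat_l; lra.
  - destruct (Nat.le_gt_cases 2 j) as [Hj2|Hj2].
    + apply H2; [lra | exact HJj | exact Hj2].
    + replace j with 1%nat by lia. unfold phi_defect. simpl INR.
      replace (1 * phi (lam * x) 1 - phi (lam * x) 1 - (1 * phi x 1 - phi x 1)) with 0 by ring.
      rewrite Rabs_R0. right. ring.
Qed.

(** The case [lam = eps = 1] of the relative estimate bounds [phi_defect] below by an absolute
    value. *)
Lemma phi_defect_nonneg : exists X, 2 <= X /\ forall x j, X <= x -> (1 <= j)%nat -> 0 <= phi_defect x j.
Proof.
  destruct (phi_defect_slowly_varying 1 1 ltac:(lra) ltac:(lra)) as (X & HX & H).
  exists X. split; [exact HX|]. intros x j Hx Hj. destruct (H x Hx) as [_ K].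
  pose proof (K j Hj). pose proof (Rabs_pos (phi_defect (1 * x) j - phi_defect x j)). lra.
Qed.

(** * The dichotomy *)

Lemma eventually_ln K : exists X, 2 <= X /\ forall x, X <= x -> K <= ln x.
Proof.
  exists (Rmax 2 (exp K)). split; [apply Rmax_l|]. intros x Hx.
  rewrite <- (ln_exp K). apply ln_le; [apply exp_pos|].
  eapply Rle_trans; [apply Rmax_r | exact Hx].
Qed.

Lemma phi_one_unbounded K : exists X, 2 <= X /\ forall x, X <= x -> K <= phi x 1.
Proof.
  destruct (eventually_ln (K + 7)) as (X & HX & H). exists X. split; [exact HX|].
  intros x Hx. specialize (H x Hx). pose proof (phi_one_ln x ltac:(lra)) as A.
  apply Rabs_le_between in A. lra.
Qed.

Lemma phi_nonneg x j : 2 <= x -> 0 <= phi x j.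
Proof.
  intros Hx. apply series_nonneg with (2 := phi_series x j Hx).
  intros m. destruct (kernel_bounds (S m) j) as (K & _). pose proof (weight_pos x m Hx). nra.
Qed.

Lemma psum_phi_defect_bounded (g : nat -> R) J : (forall n, 0 <= g n) ->
  exists X B, 2 <= X /\ forall x, X <= x -> psum (fun n => g n * phi_defect x (S n)) J <= B.
Proof.
  intros Hg.
  destruct (finite_eventually (fun j x => phi_defect x (S j) <= phi_defect_lim (S j) + 1) J) as [X H].
  { intros j _. destruct (phi_defect_near_lim (S j) 1 ltac:(lia) ltac:(lra)) as (X & _ & H).
    exists X. intros x Hx. specialize (H x Hx). apply Rabs_le_between in H. lra. }
  exists (Rmax 2 X), (psum (fun n => g n * (phi_defect_lim (S n) + 1)) J). split; [apply Rmax_l|].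
  intros x Hx. pose proof (Rmax_r 2 X). apply psum_le. intros i Hi.
  apply Rmult_le_compat_l; [apply Hg | apply H; [lra | exact Hi]].
Qed.

Lemma INR_eventually X : exists N0, (2 <= N0)%nat /\ forall N, (N0 <= N)%nat -> X <= INR N.
Proof.
  destruct (nfloor_ex (Rmax 2 X)) as [n [_ Hn]].
  { pose proof (Rmax_l 2 X). lra. }
  pose proof (Rmax_l 2 X). pose proof (Rmax_r 2 X).
  exists (Nat.max 2 (S n)). split; [lia|]. intros N HN.
  assert (H1 : INR (S n) <= INR N) by (apply le_INR; lia). rewrite S_INR in H1. lra.
Qed.

(** If a partial sum [S1] of the drift exceeded 1, the first [J] terms of the exact formula would
    equal [S1 * phi x 1] up to a bounded defect. As [nu (- N) >= 0], they are at most [phi x 1],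
    which is unbounded. *)
Lemma drift_series_le1 nu (c : R) :
  is_prob_Z nu -> (forall n, 0 <= gap nu n) -> 0 < c ->
  (forall N, (2 <= N)%nat -> is_series (fun n => gap nu n * phi (INR N) (S n))
      (phi (INR N) 1 - c * (weight_norm (INR N) * nu (- Z.of_nat N)%Z))) ->
  exists s : R, is_series (drift_term nu) s /\ 0 <= s <= 1.
Proof.
  intros Hnu Hg Hc H. pose proof (proj1 Hnu) as Hpos.
  assert (D0 : forall n, 0 <= drift_term nu n).
  { intros n. pose proof (pos_INR n). apply Rmult_le_pos; [lra | apply Hg]. }
  destruct (series_bounded (drift_term nu) 1) as (s & Hs & Hs1); [exact D0 | |].
  - intros J. apply Rnot_lt_le. intros HJ. set (S1 := psum (drift_term nu) J) in *.
    destruct (psum_phi_defect_bounded (gap nu) J Hg) as (X1 & B & HX1 & HB).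
    destruct (phi_one_unbounded ((B + 1) / (S1 - 1))) as (X2 & HX2 & HK).
    destruct (INR_eventually (Rmax X1 X2)) as (N & HN2 & HN). specialize (HN N (le_n _)).
    pose proof (Rmax_l X1 X2). pose proof (Rmax_r X1 X2). set (x := INR N) in *.
    specialize (HB x ltac:(lra)). specialize (HK x ltac:(lra)).
    assert (P : psum (fun n => gap nu n * phi x (S n)) J <= phi x 1).
    { eapply Rle_trans; [apply psum_le_series with (2 := H N HN2)|].
      - intros i. apply Rmult_le_pos; [apply Hg | apply phi_nonneg; unfold x in *; lra].
      - fold x. pose proof (weight_norm_pos x ltac:(lra)). pose proof (Hpos (- Z.of_nat N)%Z).
        assert (0 <= c * (weight_norm x * nu (- Z.of_nat N)%Z)); [|lra].
        apply Rmult_le_pos; [lra|]. apply Rmult_le_pos; lra. }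
    assert (Q : psum (fun n => gap nu n * phi_defect x (S n)) J =
       phi x 1 * S1 - psum (fun n => gap nu n * phi x (S n)) J).
    { unfold S1. rewrite <- psum_scal, <- psum_minus. apply psum_ext. intros i _.
      unfold phi_defect, drift_term, gap. rewrite S_INR. ring. }
    apply Rle_div_l in HK; [|lra]. lra.
  - exists s. split; [exact Hs|]. split; [|exact Hs1]. now apply series_nonneg with (drift_term nu).
Qed.

Definition gap_defect (nu : Z -> R) (x : R) : R := Series (fun n => gap nu n * phi_defect x (S n)).

Lemma gap_defect_series nu (s : R) :
  (forall n, 0 <= gap nu n) -> is_series (drift_term nu) s ->
  exists X, 2 <= X /\ forall x, X <= x ->
    (forall n, 0 <= phi_defect x (S n)) /\
    is_series (fun n => gap nu n * phi_defect x (S n)) (gap_defect nu x).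
Proof.
  intros Hg Hs. destruct phi_defect_nonneg as (X & HX & HG). exists X. split; [exact HX|].
  intros x Hx. assert (G0 : forall n, 0 <= phi_defect x (S n)) by (intros; apply HG; [exact Hx | lia]).
  split; [exact G0|]. apply ex_series_is.
  assert (B : forall n, Rabs (gap nu n * phi_defect x (S n)) <= phi x 1 * drift_term nu n).
  { intros n. rewrite Rabs_pos_eq by (apply Rmult_le_pos; auto).
    pose proof (phi_nonneg x (S n) ltac:(lra)).
    replace (phi x 1 * drift_term nu n) with (gap nu n * (INR (S n) * phi x 1))
      by (unfold drift_term, gap; rewrite S_INR; ring).
    apply Rmult_le_compat_l; [apply Hg|]. unfold phi_defect. lra. }
  destruct (series_dominated _ _ _ B (is_series_mult_l (phi x 1) _ _ Hs)) as [a [Ha _]].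
  now exists a.
Qed.

(** The sum is split where the drift tail falls below [eps / 2]. The head stays bounded, while in
    the tail the defect is at most [(n + 1) * phi x 1]. *)
Lemma gap_defect_small nu (s : R) eps :
  (forall n, 0 <= gap nu n) -> is_series (drift_term nu) s -> 0 < eps ->
  exists X, 2 <= X /\ forall x, X <= x -> 0 <= gap_defect nu x <= eps * phi x 1.
Proof.
  intros Hg Hs He. destruct (gap_defect_series nu s Hg Hs) as (X0 & HX0 & HE).
  pose proof (proj1 (is_series_psum _ _) Hs) as HL. apply is_lim_seq_spec in HL.
  destruct (HL (mkposreal (eps / 2) ltac:(lra))) as [J HJ]. specialize (HJ J (le_n _)).
  simpl in HJ. apply Rabs_lt_between in HJ.
  destruct (psum_phi_defect_bounded (gap nu) J Hg) as (X1 & B & HX1 & HB).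
  destruct (phi_one_unbounded (2 * B / eps)) as (X2 & HX2 & HK).
  exists (Rmax X0 (Rmax X1 X2)).
  pose proof (Rmax_l X0 (Rmax X1 X2)). pose proof (Rmax_r X0 (Rmax X1 X2)).
  pose proof (Rmax_l X1 X2). pose proof (Rmax_r X1 X2). split; [lra|]. intros x Hx.
  destruct (HE x ltac:(lra)) as [G0 HEs].
  specialize (HB x ltac:(lra)). specialize (HK x ltac:(lra)). split.
  - apply series_nonneg with (2 := HEs). intros n. apply Rmult_le_pos; auto.
  - assert (T : gap_defect nu x - psum (fun n => gap nu n * phi_defect x (S n)) J <=
       phi x 1 * (s - psum (drift_term nu) J)).
    { apply series_le with (2 := proj1 (is_series_drop _ _ J) HEs)
        (3 := is_series_mult_l (phi x 1) _ _ (proj1 (is_series_drop _ _ J) Hs)).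
      intros i. cbv beta. pose proof (phi_nonneg x (S (J + i)) ltac:(lra)).
      replace (phi x 1 * drift_term nu (J + i)) with (gap nu (J + i) * (INR (S (J + i)) * phi x 1))
        by (unfold drift_term, gap; rewrite S_INR; ring).
      apply Rmult_le_compat_l; [apply Hg|]. unfold phi_defect. lra. }
    pose proof (phi_nonneg x 1 ltac:(lra)).
    apply Rle_div_l in HK; [|lra]. nra.
Qed.

Lemma seq_equiv_div_sq (u A B : nat -> R) N0 :
  (forall N, (N0 <= N)%nat -> A N = weight_norm (INR N) * u N) ->
  seq_equiv A B -> seq_equiv u (fun N => B N / INR N ^ 2).
Proof.
  intros HA HAB eps He.
  (* The ratio [rho] of [N^2] to [weight_norm] lies in [[1, 1 + eta]], so at most 2; the two errors
     add up to [3 eta] relative to [B]. *)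
  set (eta := Rmin 1 (eps / 4)).
  assert (Heta : 0 < eta) by (apply Rmin_glb_lt; lra).
  assert (Heta1 : eta <= 1) by apply Rmin_l. assert (Heta2 : eta <= eps / 4) by apply Rmin_r.
  destruct (HAB eta Heta) as [N1 H1].
  destruct (INR_eventually (4 / eta)) as (N2 & HN2 & H2).
  exists (Nat.max N0 (Nat.max N1 N2)). intros N HN.
  specialize (HA N ltac:(lia)). specialize (H1 N ltac:(lia)). specialize (H2 N ltac:(lia)).
  assert (Hx : 2 <= INR N) by (apply (le_INR 2); lia).
  set (x := INR N) in *. pose proof (weight_norm_pos x Hx) as Hw.
  assert (Hq : 0 < x * x) by nra.
  set (rho := x * x / weight_norm x).
  assert (Hrho : 1 <= rho <= 1 + eta).
  { unfold rho. split.
    - apply Rle_div_r; [lra|]. unfold weight_norm. nra.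
    - apply Rle_div_l; [lra|]. apply Rle_div_l in H2; [|lra]. unfold weight_norm.
      assert (E : 4 * x <= x * (eta * x)) by nra.
      enough ((1 + eta) * (2 * x) <= eta * (x * x)) by nra. nra. }
  assert (Eu : u N = A N * rho / (x * x)) by (rewrite HA; unfold rho; field; lra).
  assert (E : u N - B N / x ^ 2 = ((A N - B N) * rho + B N * (rho - 1)) / (x * x))
    by (rewrite Eu; field; lra).
  replace (B N / x ^ 2) with (B N * / (x * x)) in * by (field; lra).
  rewrite E. unfold Rdiv. rewrite !Rabs_mult, <- Rmult_assoc.
  apply Rmult_le_compat_r; [apply Rabs_pos|].
  eapply Rle_trans; [apply Rabs_triang|]. rewrite !Rabs_mult.
  rewrite (Rabs_pos_eq rho), (Rabs_pos_eq (rho - 1)) by lra.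
  pose proof (Rabs_pos (B N)). pose proof (Rabs_pos (A N - B N)).
  assert (Rabs (A N - B N) * rho <= eta * Rabs (B N) * 2) by (apply Rmult_le_compat; lra).
  assert (Rabs (B N) * (rho - 1) <= Rabs (B N) * eta) by (apply Rmult_le_compat_l; lra).
  assert (eta * Rabs (B N) <= eps / 4 * Rabs (B N)) by (apply Rmult_le_compat_r; lra). nra.
Qed.

Lemma prob_concentrated nu : is_prob_Z nu -> 1 <= nu 0%Z -> nu = dirac0.
Proof.
  intros Hnu H0. pose proof (proj1 Hnu) as Hpos. pose proof (prob_pair_series nu Hnu) as Hs.
  set (f := fun n => nu (Z.of_nat n) + nu (- Z.of_nat n - 1)%Z) in *.
  assert (Hf : forall n, 0 <= f n).
  { intros n. pose proof (Hpos (Z.of_nat n)). pose proof (Hpos (- Z.of_nat n - 1)%Z). unfold f. lra. }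
  assert (F0 : f 0%nat = 1 /\ nu 0%Z = 1 /\ nu (-1)%Z = 0).
  { pose proof (psum_le_series f 1 1 Hf Hs) as K. simpl psum in K.
    pose proof (Hpos (-1)%Z). unfold f in *. simpl in *. lra. }
  assert (FS : forall n, (1 <= n)%nat -> nu (Z.of_nat n) = 0 /\ nu (- Z.of_nat n - 1)%Z = 0).
  { intros n Hn. pose proof (psum_le_series f 1 (S n) Hf Hs) as K. cbn [psum] in K.
    pose proof (psum_mono f 1 n Hf Hn) as M. simpl psum in M.
    pose proof (Hpos (Z.of_nat n)). pose proof (Hpos (- Z.of_nat n - 1)%Z).
    assert (f n <= 0) by lra. unfold f in H2. lra. }
  apply functional_extensionality. intros k. unfold dirac0.
  destruct (Z.eqb_spec k 0) as [->|Hk]; [lra|].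
  destruct (Z.lt_ge_cases k 0) as [Hk'|Hk'].
  - destruct (Z.eq_dec k (-1)) as [->|Hk1]; [lra|].
    destruct (FS (Z.to_nat (- k - 1)) ltac:(lia)) as [_ K].
    replace (- Z.of_nat (Z.to_nat (- k - 1)) - 1)%Z with k in K by lia. exact K.
  - destruct (FS (Z.to_nat k) ltac:(lia)) as [K _]. now rewrite Z2Nat.id in K by lia.
Qed.

(** Otherwise the drift reduces to [nu 0 - nu (-2) = 1], which forces [nu] to be the Dirac mass at
    0. *)
Lemma gap_pos_exists nu :
  is_prob_Z nu -> nu <> dirac0 -> (forall n, 0 <= gap nu n) ->
  is_series (drift_term nu) 1 -> exists i, (1 <= i)%nat /\ 0 < gap nu i.
Proof.
  intros Hnu Hne Hg Hs. apply NNPP. intros Hno. apply Hne, prob_concentrated; [exact Hnu|].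
  assert (Z : forall i, (1 <= i)%nat -> drift_term nu i = 0).
  { intros i Hi. destruct (Hg i) as [K|K]; [exfalso; apply Hno; now exists i|].
    unfold drift_term. unfold gap in K. rewrite <- K. ring. }
  pose proof (is_series_uniq _ _ _ Hs (is_series_finite _ 1 Z)) as E.
  simpl psum in E. unfold drift_term in E. simpl in E.
  pose proof (proj1 Hnu (-2)%Z). lra.
Qed.

(** One term suffices: the gap index [i >= 1] corresponds to [j = i + 1 >= 2], where the limit of
    the defect is positive. *)
Lemma gap_defect_lower nu i :
  (forall n, 0 <= gap nu n) -> is_series (drift_term nu) 1 -> (1 <= i)%nat -> 0 < gap nu i ->
  exists d X, 0 < d /\ 2 <= X /\ forall x, X <= x -> d <= gap_defect nu x.
Proof.
  intros Hg Hs Hi Hgi. destruct (gap_defect_series nu 1 Hg Hs) as (X0 & HX0 & HE).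
  pose proof (phi_defect_lim_pos (S i) ltac:(lia)) as HG.
  destruct (phi_defect_near_lim (S i) (phi_defect_lim (S i) / 2) ltac:(lia) ltac:(lra)) as (X1 & HX1 & H1).
  exists (gap nu i * (phi_defect_lim (S i) / 2)), (Rmax X0 X1).
  pose proof (Rmax_l X0 X1). pose proof (Rmax_r X0 X1).
  split; [apply Rmult_lt_0_compat; lra|]. split; [lra|]. intros x Hx.
  destruct (HE x ltac:(lra)) as [G0 HEs]. specialize (H1 x ltac:(lra)).
  apply Rabs_le_between in H1.
  assert (T0 : forall n, 0 <= gap nu n * phi_defect x (S n)) by (intros; apply Rmult_le_pos; auto).
  pose proof (psum_le_series _ _ (S i) T0 HEs) as K. cbn [psum] in K.
  pose proof (psum_nonneg (fun n => gap nu n * phi_defect x (S n)) i (fun n _ => T0 n)).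
  assert (gap nu i * (phi_defect_lim (S i) / 2) <= gap nu i * phi_defect x (S i)) by (apply Rmult_le_compat_l; lra).
  lra.
Qed.

Lemma gap_defect_slowly_varying nu lam eps :
  (forall n, 0 <= gap nu n) -> is_series (drift_term nu) 1 -> 0 < lam -> 0 < eps ->
  exists X, forall x, X <= x -> Rabs (gap_defect nu (lam * x) - gap_defect nu x) <= eps * gap_defect nu x.
Proof.
  intros Hg Hs Hl He. destruct (gap_defect_series nu 1 Hg Hs) as (X0 & HX0 & HE).
  destruct (phi_defect_slowly_varying lam eps Hl He) as (X1 & HX1 & H1).
  exists (Rmax (Rmax X0 X1) (X0 / lam)). intros x Hx.
  pose proof (Rmax_l (Rmax X0 X1) (X0 / lam)). pose proof (Rmax_r (Rmax X0 X1) (X0 / lam)).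
  pose proof (Rmax_l X0 X1). pose proof (Rmax_r X0 X1).
  assert (X0 <= lam * x).
  { assert (K : X0 / lam <= x) by lra. apply Rle_div_l in K; lra. }
  destruct (HE x ltac:(lra)) as [G0 E1]. destruct (HE (lam * x) ltac:(lra)) as [_ E2].
  destruct (H1 x ltac:(lra)) as [_ K].
  apply series_abs_le with (2 := is_series_sub _ _ _ _ E2 E1) (3 := is_series_mult_l eps _ _ E1).
  intros n. replace (gap nu n * phi_defect (lam * x) (S n) - gap nu n * phi_defect x (S n)) with
    (gap nu n * (phi_defect (lam * x) (S n) - phi_defect x (S n))) by ring.
  rewrite Rabs_mult, (Rabs_pos_eq (gap nu n)) by apply Hg.
  replace (eps * (gap nu n * phi_defect x (S n))) with (gap nu n * (eps * phi_defect x (S n))) by ring.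
  apply Rmult_le_compat_l; [apply Hg | apply K; lia].
Qed.

Theorem theorem1p2 (nu : Z -> R) :
  is_prob_Z nu ->
  harmonic_on_pos nu hdown ->
  nu <> dirac0 ->
  (forall k : Z, (1 <= k)%Z -> nu (k - 1)%Z >= nu (- k - 1)%Z) ->
  let case_i :=
    (exists s : R, is_series (drift_term nu) s /\ 0 <= s < 1) /\
    (exists c : R, 0 < c /\
       seq_equiv (fun n => nu (- Z.of_nat n)%Z)
                 (fun n => c * ln (INR n) / (INR n) ^ 2)) in
  let case_ii :=
    is_series (drift_term nu) 1 /\
    (exists L : R -> R,
       slowly_varying L /\
       seq_littleo (fun n => L (INR n)) (fun n => ln (INR n)) /\
       seq_bigO (fun _ => 1) (fun n => L (INR n)) /\
       seq_equiv (fun n => nu (- Z.of_nat n)%Z)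
                 (fun n => L (INR n) / (INR n) ^ 2)) in
  (case_i \/ case_ii) /\ ~ (case_i /\ case_ii).
Proof.
  intros Hnu Hh0 Hne Hge case_i case_ii. split.
  2: { intros [[(s & Hs & Hs1) _] [H1 _]]. pose proof (is_series_uniq _ _ _ Hs H1). lra. }
  assert (Hg : forall n, 0 <= gap nu n).
  { intros n. pose proof (Hge (Z.of_nat n + 1)%Z ltac:(lia)) as K. unfold gap.
    replace (Z.of_nat n + 1 - 1)%Z with (Z.of_nat n) in K by lia.
    replace (- (Z.of_nat n + 1) - 1)%Z with (- Z.of_nat n - 2)%Z in K by lia. lra. }
  destruct (exact_formula nu Hnu Hh0 Hg) as (c & Hc & Hform).
  destruct (drift_series_le1 nu c Hnu Hg Hc Hform) as (s & Hs & Hs0 & Hs1).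
  destruct (gap_defect_series nu s Hg Hs) as (X0 & HX0 & HE).
  destruct (INR_eventually X0) as (N0 & HN0 & HX).
  (* Writing [phi x j] as [j * phi x 1 - phi_defect x j] in the exact formula and summing makes the
     drift [s] appear. *)
  assert (Hval : forall N, (N0 <= N)%nat ->
     ((1 - s) * phi (INR N) 1 + gap_defect nu (INR N)) / c = weight_norm (INR N) * nu (- Z.of_nat N)%Z).
  { intros N HN. destruct (HE (INR N) (HX N HN)) as [_ K].
    pose proof (is_series_sub _ _ _ _ (is_series_mult_l (phi (INR N) 1) _ _ Hs) K) as K'.
    assert (K2 := Hform N ltac:(lia)).
    assert (E : phi (INR N) 1 * s - gap_defect nu (INR N) =
      phi (INR N) 1 - c * (weight_norm (INR N) * nu (- Z.of_nat N)%Z)).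
    { apply is_series_uniq with (2 := K2). apply is_series_eq with (3 := K'); [|reflexivity].
      intros n. unfold phi_defect, drift_term, gap. rewrite S_INR. ring. }
    replace ((1 - s) * phi (INR N) 1 + gap_defect nu (INR N)) with
      (c * (weight_norm (INR N) * nu (- Z.of_nat N)%Z)) by lra. field. lra. }
  destruct (Rle_lt_or_eq_dec s 1 Hs1) as [Hlt | ->].
  - left. split; [exists s; split; [exact Hs | lra]|].
    exists ((1 - s) / c). split; [apply Rdiv_lt_0_compat; lra|].
    apply seq_equiv_div_sq with (1 := Hval). intros eps He.
    set (eta := eps * (1 - s) / 2).
    assert (Heta : 0 < eta) by (unfold eta; assert (0 < eps * (1 - s)) by (apply Rmult_lt_0_compat; lra); lra).
    destruct (gap_defect_small nu s eta Hg Hs Heta) as (X1 & HX1 & H1).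
    (* Past this threshold [eta * ln x] absorbs the constant errors [7 (1 - s)] and [7 eta] due to
       [phi_one_ln]; the total is at most [2 eta * ln x]. *)
    destruct (eventually_ln (7 * ((1 - s) + eta) / eta)) as (X2 & HX2 & H2).
    destruct (INR_eventually (Rmax X1 X2)) as (N & HN2 & HN). exists N. intros n Hn.
    specialize (HN n Hn). pose proof (Rmax_l X1 X2). pose proof (Rmax_r X1 X2).
    set (x := INR n) in *. specialize (H1 x ltac:(lra)). specialize (H2 x ltac:(lra)).
    pose proof (phi_one_ln x ltac:(lra)) as P. apply Rabs_le_between in P.
    apply Rle_div_l in H2; [|lra].
    assert (Hln : 0 <= ln x) by (rewrite <- ln_1; apply ln_le; lra).
    replace (((1 - s) * phi x 1 + gap_defect nu x) / c - (1 - s) / c * ln x) with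
      (((1 - s) * (phi x 1 - ln x) + gap_defect nu x) * / c) by (field; lra).
    replace ((1 - s) / c * ln x) with ((1 - s) * ln x * / c) by (field; lra).
    assert (0 < / c) by now apply Rinv_0_lt_compat.
    rewrite !(Rabs_mult _ (/ c)), <- Rmult_assoc. apply Rmult_le_compat_r; [apply Rabs_pos|].
    rewrite (Rabs_pos_eq ((1 - s) * ln x)) by (apply Rmult_le_pos; lra).
    replace (eps * ((1 - s) * ln x)) with (2 * eta * ln x) by (unfold eta; field).
    assert (gap_defect nu x <= eta * (ln x + 7)).
    { apply Rle_trans with (1 := proj2 H1). apply Rmult_le_compat_l; lra. }
    assert (- (7 * (1 - s)) <= (1 - s) * (phi x 1 - ln x) <= 7 * (1 - s)) by nra.
    apply Rabs_le. lra.
  - right. split; [exact Hs|]. exists (fun x => gap_defect nu x / c).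
    destruct (gap_pos_exists nu Hnu Hne Hg Hs) as (i & Hi & Hgi).
    destruct (gap_defect_lower nu i Hg Hs Hi Hgi) as (d & Xd & Hd & HXd & Hlow).
    split; [|split; [|split]].
    + intros lam Hl. apply is_lim_spec. intros [eps He]. simpl.
      destruct (gap_defect_slowly_varying nu lam (eps / 2) Hg Hs Hl ltac:(lra)) as (X1 & H1).
      exists (Rmax Xd X1). intros x Hx. pose proof (Rmax_l Xd X1). pose proof (Rmax_r Xd X1).
      specialize (H1 x ltac:(lra)). specialize (Hlow x ltac:(lra)).
      replace (gap_defect nu (lam * x) / c / (gap_defect nu x / c) - 1) with
        ((gap_defect nu (lam * x) - gap_defect nu x) / gap_defect nu x) by (field; lra).
      rewrite Rabs_div by lra. rewrite (Rabs_pos_eq (gap_defect nu x)) by lra.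
      apply Rlt_div_l; [lra|].
      assert (0 < eps * gap_defect nu x) by (apply Rmult_lt_0_compat; lra). lra.
    + intros eps He. assert (Hec : 0 < eps * c / 2).
      { assert (0 < eps * c) by (apply Rmult_lt_0_compat; lra). lra. }
      destruct (gap_defect_small nu 1 (eps * c / 2) Hg Hs Hec) as (X1 & HX1 & H1).
      (* Once [ln x >= 7], the bound [phi x 1 <= ln x + 7] gives [phi x 1 <= 2 * ln x]. *)
      destruct (eventually_ln 7) as (X2 & HX2 & H2).
      destruct (INR_eventually (Rmax X1 X2)) as (N & HN2 & HN). exists N. intros n Hn.
      specialize (HN n Hn). pose proof (Rmax_l X1 X2). pose proof (Rmax_r X1 X2).
      set (x := INR n) in *. specialize (H1 x ltac:(lra)). specialize (H2 x ltac:(lra)).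
      pose proof (phi_one_ln x ltac:(lra)) as P. apply Rabs_le_between in P.
      rewrite (Rabs_pos_eq (ln x)) by lra.
      rewrite Rabs_pos_eq by (apply Rdiv_le_0_compat; lra).
      apply Rle_div_l; [lra|]. apply Rle_trans with (1 := proj2 H1).
      replace (eps * ln x * c) with (eps * c / 2 * (2 * ln x)) by field.
      apply Rmult_le_compat_l; lra.
    + exists (c / d). split; [now apply Rdiv_lt_0_compat|].
      destruct (INR_eventually Xd) as (N & HN2 & HN). exists N. intros n Hn.
      specialize (HN n Hn). specialize (Hlow _ HN).
      rewrite Rabs_R1, Rabs_pos_eq by (apply Rdiv_le_0_compat; lra).
      replace (c / d * (gap_defect nu (INR n) / c)) with (gap_defect nu (INR n) / d) by (field; lra).
      apply Rle_div_r; lra.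
    + apply seq_equiv_div_sq with (1 := Hval). intros eps He. exists 0%nat. intros n _.
      replace (((1 - 1) * phi (INR n) 1 + gap_defect nu (INR n)) / c - gap_defect nu (INR n) / c) with 0
        by (field; lra).
      rewrite Rabs_R0. apply Rmult_le_pos; [lra | apply Rabs_pos].
Qed.
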